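(* Let $p,Q$ be real-valued measurable functions on the finite interval $\mathcal J=(a,b)$ with $1/p,\ Q/p,\ Q^2/p\in L_1(\mathcal J)$, and for a unitary operator $K$ on $\mathbb C^2$ let $L_K$ be the self-adjoint operator on $L_2(\mathcal J,\mathbb C)$ defined in the context. If unitary operators $K_n$ on $\mathbb C^2$ converge to an operator $K$, then $$\left\|(L_K-\lambda)^{-1}-(L_{K_n}-\lambda)^{-1}\right\|\to0,\quad n\to\infty,\qquad \operatorname{Im}\lambda\neq0.$$ The converse is also true. That is, for any fixed $\lambda\in\mathbb C\setminus\mathbb R$ the mapping $K\mapsto(L_K-\lambda)^{-1}$, defined on the set of unitary operators on $\mathbb C^2$, is a homeomorphism (onto its image, with the operator-norm topologies).
   Context: Let $\mathcal J=(a,b)$ be a finite interval and $L_2=L_2(\mathcal J,\mathbb C)$; $p$ is finite and nonzero a.e. The formal expression $-(py')'+qy$ with $q=Q'$ (distributional derivative) is interpreted through the quasi-derivatives $$D^{[0]}y=y,\qquad D^{[1]}y=py'-Qy,\qquad D^{[2]}y=(D^{[1]}y)'+\frac Qp D^{[1]}y+\frac{Q^2}{p}y$$ as $l[y]:=-D^{[2]}y$. The maximal operator is $L_{\max}y=l[y]$ with $\operatorname{Dom}(L_{\max})=\{y\in L_2:\ y,D^{[1]}y\in AC([a,b],\mathbb C),\ D^{[2]}y\in L_2\}$. Define $\Gamma_1,\Gamma_2:\operatorname{Dom}(L_{\max})\to\mathbb C^2$ by $$\Gamma_1y=(D^{[1]}y(a),-D^{[1]}y(b)),\qquad \Gamma_2y=(y(a),y(b)).$$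 For a linear operator $K$ on $\mathbb C^2$, $L_K$ denotes the restriction of $L_{\max}$ to the set of $y\in\operatorname{Dom}(L_{\max})$ satisfying $$(K-I)\Gamma_1y+i(K+I)\Gamma_2y=0.$$ When $K$ is unitary, $L_K$ is self-adjoint. *)

(* Defs.v *)
From HB Require Import structures.
From mathcomp Require Import all_boot all_order all_algebra.
From mathcomp Require Import complex.
From mathcomp Require Import all_classical all_reals all_analysis.

Set Implicit Arguments.
Unset Strict Implicit.
Unset Printing Implicit Defensive.

Import Order.TTheory GRing.Theory Num.Theory.
Import numFieldNormedType.Exports.

Local Open Scope classical_set_scope.
Local Open Scope ring_scope.
Local Open Scope complex_scope.

(* Operator norm of [T] on the space [V] (a set of vectors) with norm [N]; it
   is [+oo] when [T] is unbounded. *)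
Definition opnorm (R : realType) (E : Type) (V : set E) (N : E -> \bar R)
    (T : E -> E) : \bar R :=
  ereal_inf [set M%:E | M in [set M : R |
    0 <= M /\ forall v, V v -> (N (T v) <= M%:E * N v)%E]].

(* [F] is a homeomorphism of the metric space (A, dX) onto its image in the
   metric space given by [dY], whose equality of points is [eqY]: [F] is
   injective, and [F] and its inverse are continuous. *)
Definition homeomorphism_onto_image (R : realType) (X Y : Type) (A : set X)
    (dX : X -> X -> \bar R) (eqY : Y -> Y -> Prop) (dY : Y -> Y -> \bar R)
    (F : X -> Y) : Prop :=
  [/\ forall x x', A x -> A x' -> eqY (F x) (F x') -> x = x',
      forall x, A x -> forall e : R, 0 < e -> exists2 d : R, 0 < d &
        forall x', A x' -> (dX x' x < d%:E)%E -> (dY (F x') (F x) < e%:E)%E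
    & forall x, A x -> forall e : R, 0 < e -> exists2 d : R, 0 < d &
        forall x', A x' -> (dY (F x') (F x) < d%:E)%E -> (dX x' x < e%:E)%E].

Section functions_on_an_interval.
Context (R : realType) (a b : R).

Local Notation C := R[i].
Local Notation mu := (@lebesgue_measure R).
Local Notation J := (`]a, b[%classic : set R).

(* Elements of spaces of classes of functions on (a, b) are represented by
   functions on R; their values outside of [a, b] are irrelevant. *)
Definition aeJ (V : Type) (f g : R -> V) : Prop := f = g %[ae mu in J].

(* [measurable_fun] refers to the Borel sets; up to almost everywhere equality
   this becomes Lebesgue measurability. *)
Definition lebesgue_measurable (f : R -> R) : Prop :=
  exists2 g : R -> R, measurable_fun J g & aeJ f g.

Definition L1 (f : R -> R) : Prop :=
  exists2 g : R -> R, mu.-integrable J (EFin \o g) & aeJ f g.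

Definition L2norm (f : R -> C) : \bar R :=
  'N[mu]_2%:E[(fun x => (Normc.normc (f x))%:E) \_ J].

Definition L2 : set (R -> C) := [set f |
  [/\ lebesgue_measurable (fun x => complex.Re (f x)),
      lebesgue_measurable (fun x => complex.Im (f x))
    & (L2norm f < +oo)%E]].

(* Absolute continuity on [a, b]. *)
Definition AC (f : R -> C) : Prop :=
  forall e : R, 0 < e -> exists2 d : R, 0 < d &
  forall (n : nat) (u v : 'I_n -> R),
    (forall i, [/\ a <= u i, u i < v i & v i <= b]) ->
    trivIset [set: 'I_n] (fun i => `]u i, v i[%classic) ->
    \sum_i (v i - u i) < d ->
    \sum_i Normc.normc (f (v i) - f (u i)) < e.

Definition cderive (f : R -> C) (x : R) : C :=
  derive1 (fun t => complex.Re (f t)) x +i* derive1 (fun t => complex.Im (f t)) x.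

(* The representative of the class of [f] which is absolutely continuous on
   [a, b]; it is unique on [a, b] since a < b. If there is none, this is [f]
   itself, and then [f] is not in [AC]. *)
Definition ACrep (f : R -> C) : R -> C := xget f [set u | AC u /\ aeJ u f].

(* Norm of the difference of two operators of L_2. *)
Definition L2opdist (S T : (R -> C) -> R -> C) : \bar R :=
  opnorm L2 L2norm (fun f x => S f x - T f x).

Definition L2opeq (S T : (R -> C) -> R -> C) : Prop :=
  forall f, L2 f -> aeJ (S f) (T f).

(* (L - lambda)^-1 for an operator [L] of L_2 with domain [D]: it maps [f] to
   the solution y in D of L y - lambda y = f. *)
Definition resolvent (D : set (R -> C)) (L : (R -> C) -> R -> C) (lambda : C)
    (f : R -> C) : R -> C :=
  xget (cst 0) [set y | D y /\ aeJ (fun x => L y x - lambda * y x) f].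

(* L - lambda is a bijection from D onto L_2 with a bounded inverse. *)
Definition in_resolvent_set (D : set (R -> C)) (L : (R -> C) -> R -> C)
    (lambda : C) : Prop :=
  [/\ forall f, L2 f ->
        exists2 y, D y & aeJ (fun x => L y x - lambda * y x) f,
      forall y, D y -> aeJ (fun x => L y x - lambda * y x) (cst 0) ->
        aeJ y (cst 0)
    & (opnorm L2 L2norm (resolvent D L lambda) < +oo)%E].

Section sturm_liouville.
Variables p Q : R -> R.

Definition D1 (y : R -> C) : R -> C :=
  ACrep (fun x => (p x)%:C * cderive y x - (Q x)%:C * y x).

Definition D2 (y : R -> C) : R -> C := fun x =>
  cderive (D1 y) x + (Q x / p x)%:C * D1 y x + (Q x ^+ 2 / p x)%:C * y x.

Definition Lmax (y : R -> C) : R -> C := fun x => - D2 y x.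

Definition DomLmax : set (R -> C) :=
  [set y | [/\ L2 y, AC y, AC (D1 y) & L2 (D2 y)]].

Definition Gamma1 (y : R -> C) : 'cV[C]_2 :=
  \col_(i < 2) [:: D1 y a; - D1 y b]`_i.

Definition Gamma2 (y : R -> C) : 'cV[C]_2 :=
  \col_(i < 2) [:: y a; y b]`_i.

(* L_K is the restriction of [Lmax] to [DomLK K]. *)
Definition DomLK (K : 'M[C]_2) : set (R -> C) :=
  [set y | DomLmax y /\
    (K - 1%:M) *m Gamma1 y + 'i *: ((K + 1%:M) *m Gamma2 y) = 0].

Definition resolventLK (lambda : C) (K : 'M[C]_2) : (R -> C) -> R -> C :=
  resolvent (DomLK K) Lmax lambda.

End sturm_liouville.
End functions_on_an_interval.

Definition C2norm (R : realType) (v : 'cV[R[i]]_2) : \bar R :=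
  (Num.sqrt (\sum_(i < 2) Normc.normc (v i 0) ^+ 2))%:E.

(* Norm of the difference of two operators of C^2. *)
Definition C2opdist (R : realType) (A B : 'M[R[i]]_2) : \bar R :=
  opnorm setT (@C2norm R) (fun v => A *m v - B *m v).

(* Main.v *)
Require Import Defs.
From HB Require Import structures.
From mathcomp Require Import all_boot all_order all_algebra.
From mathcomp Require Import complex.
From mathcomp Require Import all_classical all_reals all_analysis.
From mathcomp Require Import measurable_realfun.
From mathcomp Require Import ring lra.
Import Order.TTheory GRing.Theory Num.Theory.
Import numFieldNormedType.Exports.
Set Implicit Arguments.
Unset Strict Implicit.
Unset Printing Implicit Defensive.
Local Open Scope classical_set_scope.
Local Open Scope ring_scope.

(** Writing [u = D1 y], the equation [l[y] - lambda y = f] is the first order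
    system [y' = g2 y + g1 u], [u' = - g2 u - (g3 + lambda) y - f] with integrable
    [g1 = 1/p], [g2 = Q/p], [g3 = Q^2/p].  Picard iteration gives a fundamental
    system [phi_0, phi_1], and variation of constants a particular solution [y_f],
    so that every solution is [y_f + c_0 phi_0 + c_1 phi_1].  The boundary condition
    of [K] reads [K (Gamma1 + i Gamma2) y = (Gamma1 - i Gamma2) y], hence is a 2 x 2
    linear system for [c], with matrix [K A - B].  For unitary [K] and nonreal
    [lambda], Green's formula makes that matrix invertible, so that [c] depends
    continuously on [K], with a bound in terms of the L2 norm of [f].

    Conversely, the pair of vectors [(Gamma1 + i Gamma2) y], [(Gamma1 - i Gamma2) y]
    can be prescribed by the choice of [f] in L2.  For the solution [y] of the
    problem of [K] with [(Gamma1 + i Gamma2) y = e_j] and the solution [y'] of the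
    problem of [K'] with the same [f], the difference [y' - y] is a combination of
    [phi_0, phi_1], whose coefficients are controlled by its L2 norm; the two boundary
    conditions express [(K' - K) e_j] by these coefficients. *)

(** * Absolutely continuous functions *)

(** The operators are defined with pointwise derivatives and the epsilon-delta form of absolute
    continuity, while the argument needs the absolutely continuous functions to be the primitives of
    integrable ones. A large part of the proof is this equivalence, obtained from the Jordan
    decomposition and a Radon-Nikodym density of the Stieltjes measure. Most estimates then compare
    derivatives ([dac_compare]) rather than integrals.

    Since K - 1 and K + 1 may both be singular, neither is inverted: unitarity enters as the
    equality of the norms of Gamma1 + i Gamma2 and Gamma1 - i Gamma2, which is the vanishing of the
    boundary term in Green's formula.

    Prescribing both boundary vectors amounts to prescribing y and D1 y at both ends. The values at
    a are initial values; those at b are governed by the integrals of f phi_i, which take any values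
    because phi_0, phi_1 are linearly independent in L2 and so have dual functions g_j. Integration
    against the same g_j recovers the coefficients of a combination of phi_0, phi_1, whence their
    bound by its L2 norm. *)

Section absolute_continuity.
Context (R : realType) (a b : R).
Local Notation mu := (@lebesgue_measure R).
Local Notation J := (`]a, b[%classic : set R).

(* Families indexed by any finite type, possibly with empty intervals: both are
   needed when the intervals of a family are subdivided. *)
Definition acr (f : R -> R) : Prop :=
  forall e : R, 0 < e -> exists2 d : R, 0 < d &
  forall (I : finType) (u v : I -> R),
    (forall i, [/\ a <= u i, u i <= v i & v i <= b]) ->
    trivIset [set: I] (fun i => `]u i, v i[%classic) ->
    \sum_i (v i - u i) < d ->
    \sum_i `|f (v i) - f (u i)| < e.

Lemma acr_uniform_continuous f : acr f -> forall e, 0 < e ->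
  exists2 d, 0 < d & forall x y, a <= x <= b -> a <= y <= b ->
    `|x - y| < d -> `|f x - f y| < e.
Proof.
move=> af e /af[d d0 H]; exists d => // x y; wlog xy : x y / y <= x => [W|].
  move=> hx hy; have [/W|/ltW /W] := leP y x; first exact.
  by rewrite distrC (distrC (f x)); apply.
move=> /andP[ax xb] /andP[ay yb]; rewrite ger0_norm ?subr_ge0// => xyd.
have := H 'I_1 (fun=> y) (fun=> x).
rewrite !big_ord_recl !big_ord0 !addr0; apply => // i j _ _ _.
by rewrite !ord1.
Qed.

(** Cutting each interval along a partition gives a disjoint family of the same total length,
    indexed by pairs of an interval and a rank in its partition; so the bound on increments also
    bounds sums of variations. *)
Lemma acr_partition f e d : (forall (I : finType) (u v : I -> R),
    (forall i, [/\ a <= u i, u i <= v i & v i <= b]) ->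
    trivIset [set: I] (fun i => `]u i, v i[%classic) ->
    \sum_i (v i - u i) < d -> \sum_i `|f (v i) - f (u i)| < e) ->
  forall (I : finType) (u v : I -> R) (s : I -> seq R),
    (forall i, [/\ a <= u i, u i <= v i & v i <= b]) ->
    trivIset [set: I] (fun i => `]u i, v i[%classic) ->
    (forall i, itv_partition (u i) (v i) (s i)) ->
    \sum_i (v i - u i) < d ->
    \sum_i variation (u i) (v i) f (s i) < e.
Proof.
move=> H I u v s uv tuv sP sd.
pose U (k : {i : I & 'I_(size (s i))}) :=
  nth (v (tag k)) (u (tag k) :: s (tag k)) (tagged k).
pose V (k : {i : I & 'I_(size (s i))}) :=
  nth (v (tag k)) (u (tag k) :: s (tag k)) (tagged k).+1.
have sm i (m n : nat) : (m <= n)%N -> (n < (size (s i)).+1)%N ->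
    nth (v i) (u i :: s i) m <= nth (v i) (u i :: s i) n.
  move=> mn ns; have [pth _] := sP i.
  have srt : sorted <=%O (u i :: s i).
    by apply: (@sub_sorted _ <%R <=%R _ (u i :: s i) pth) => x y /ltW.
  by apply: (sorted_leq_nth le_trans lexx (v i) srt); rewrite ?inE//= (leq_ltn_trans mn).
have UV : forall k, [/\ u (tag k) <= U k, U k <= V k & V k <= v (tag k)].
  move=> [i k]; rewrite /U /V; split.
  - by apply: (itv_partition_nth_ge _ (sP i)); rewrite ltnW// ltnS.
  - by apply: (sm i k k.+1) => //=; rewrite ltnS.
  - by apply: (itv_partition_nth_le _ (sP i)); rewrite ltnS.
have := H _ U V; rewrite /U /V.
have big2 (F : forall i : I, nat -> R) :
    \sum_(k : {i : I & 'I_(size (s i))}) F (tag k) (tagged k) =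
    \sum_i \sum_(0 <= n < size (s i)) F i n.
  by under [RHS]eq_bigr do rewrite big_mkord; rewrite sig_big_dep.
rewrite (big2 (fun i n => nth (v i) (u i :: s i) n.+1 - nth (v i) (u i :: s i) n)).
rewrite (big2 (fun i n => `|f (nth (v i) (u i :: s i) n.+1) - f (nth (v i) (u i :: s i) n)|)).
apply.
- by move=> k; have [] := UV k; rewrite /U /V; have [? ? ?] := uv (tag k);
    split=> //; [apply: le_trans; eassumption|apply: le_trans; eassumption].
- move=> k l _ _ [z []] /=; rewrite !in_itv /= => /andP[z1 z2] /andP[z3 z4].
  have [k1 k2 k3] := UV k; have [l1 l2 l3] := UV l.
  have tkl : tag k = tag l.
    apply: tuv => //; exists z; split; rewrite /= in_itv /=; apply/andP; split.
    - exact: le_lt_trans z1.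
    - exact: lt_le_trans k3.
    - exact: le_lt_trans z3.
    - exact: lt_le_trans l3.
  move: k l tkl z1 z2 z3 z4 {k1 k2 k3 l1 l2 l3} => [i k] [j l] /= ij; subst j => z1 z2 z3 z4.
  congr existT; apply: val_inj => /=.
  have [kl|lk|//] := ltngtP k l.
  + have := sm i k.+1 l kl; rewrite ltnW ?ltnS// => /(_ isT) h.
    by have := lt_trans z3 (lt_le_trans z2 h); rewrite ltxx.
  + have := sm i l.+1 k lk; rewrite ltnW ?ltnS// => /(_ isT) h.
    by have := lt_trans z1 (lt_le_trans z4 h); rewrite ltxx.
- rewrite (le_lt_trans _ sd)//; apply: ler_sum => i _.
  rewrite telescope_sumr//= (itv_partition_nth_size _ (sP i))//.
Qed.

(** For the [d] attached to the bound 1, the variation over an interval shorter than [d] is at most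
    1; longer intervals are reached by induction in steps of [d / 2]. *)
Lemma acr_BV f : acr f -> forall x y, a <= x -> x <= y -> y <= b ->
  bounded_variation x y f.
Proof.
move=> /(_ _ ltr01)[d d0 /acr_partition H].
have small x y : a <= x -> x <= y -> y <= b -> y - x < d ->
    bounded_variation x y f.
  move=> ax xy yb xyd; exists 1 => _ [s xys <-].
  have := H 'I_1 (fun=> x) (fun=> y) (fun=> s).
  rewrite !big_ord_recl !big_ord0 !addr0 => K; apply/ltW/K => // i j _ _ _.
  by rewrite !ord1.
have main n x : a <= x -> x <= b -> x - a <= n%:R * (d / 2) ->
    bounded_variation a x f.
  elim: n x => [|n IH] x ax xb.
    rewrite mul0r subr_le0 => xa.
    have -> : x = a by apply/le_anti; rewrite xa ax.
    exact: bounded_variationxx.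
  move=> xn; pose c := Num.max a (x - d / 2).
  have ac : a <= c by rewrite le_max lexx.
  have cx : c <= x by rewrite ge_max ax /= gerBl ltW// divr_gt0.
  have acf : bounded_variation a c f.
    apply: IH => //; first exact: le_trans xb.
    have nd : 0 <= n%:R * (d / 2) by rewrite mulr_ge0// divr_ge0// ltW.
    by rewrite lerBlDr ge_max lerDr nd /=; move: xn; rewrite -natr1; lra.
  have cxf : bounded_variation c x f.
    apply: small => //; rewrite ltrBlDr -ltrBlDl lt_max; apply/orP; right; lra.
  apply/bounded_variationP => //.
  rewrite (total_variationD _ ac cx) fin_numD; apply/andP; split.
    exact/bounded_variationP.
  exact/bounded_variationP.
move=> x y ax xy yb.
apply: (bounded_variationr ax xy).
apply: (main (Num.bound ((y - a) / (d / 2)))) => //; first exact: le_trans xy.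
rewrite -ler_pdivrMr ?divr_gt0//; apply/ltW/archi_boundP.
by rewrite !divr_ge0 ?subr_ge0// ?(le_trans ax)// ltW.
Qed.

Lemma total_variation_adherent (f : R -> R) x y e : x <= y -> bounded_variation x y f ->
  0 < e -> exists2 s, itv_partition x y s &
    fine (total_variation x y f) < variation x y f s + e.
Proof.
move=> xy bv e0; have nonempty : variations x y f !=set0.
  move: xy; rewrite le_eqVlt => /predU1P[->|xy]; last exact: variations_neq0.
  by rewrite variationsxx; exists 0.
have hs : has_sup (variations x y f) by split.
rewrite /total_variation ereal_sup_EFin//=.
have [_ [s ss <-] h] := sup_adherent e0 hs.
by exists s => //; rewrite -ltrBlDr.
Qed.

Definition var_from (f : R -> R) x := fine (total_variation a x f).

Lemma var_fromB f : acr f -> forall x y, a <= x -> x <= y -> y <= b ->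
  var_from f y - var_from f x = fine (total_variation x y f).
Proof.
move=> af x y ax xy yb; rewrite /var_from (total_variationD _ ax xy).
have fx : total_variation a x f \is a fin_num.
  by apply/bounded_variationP => //; apply: acr_BV => //; apply: le_trans yb.
have fy : total_variation x y f \is a fin_num.
  by apply/bounded_variationP => //; apply: acr_BV.
by rewrite fineD// addrAC subrr add0r.
Qed.

Lemma acr_var_from f : acr f -> acr (var_from f).
Proof.
move=> af e e0; have e20 : 0 < e / 2 by rewrite divr_gt0.
have [d d0 /acr_partition H] := af _ e20; exists d => // I u v uv tuv sd.
(* Each total variation is approximated by a partition; the errors together cost at most [e / 2].
   The successor covers the empty family. *)
have eta0 : 0 < e / 2 / #|I|.+1%:R by rewrite divr_gt0.
have /choice[s sP] : forall i, exists s, itv_partition (u i) (v i) s /\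
    fine (total_variation (u i) (v i) f) <=
      variation (u i) (v i) f s + e / 2 / #|I|.+1%:R.
  move=> i; have [? ? ?] := uv i.
  have [s ? ?] := @total_variation_adherent f (u i) (v i) _ ltac:(by []) ltac:(exact: acr_BV) eta0.
  by exists s; split => //; apply: ltW.
rewrite (eq_bigr (fun i => fine (total_variation (u i) (v i) f))); last first.
  move=> i _; have [? ? ?] := uv i; rewrite var_fromB// ger0_norm// fine_ge0//.
  exact: total_variation_ge0.
apply: (@le_lt_trans _ _ (\sum_i (variation (u i) (v i) f (s i) + e / 2 / #|I|.+1%:R))).
  by apply: ler_sum => i _; have [] := sP i.
rewrite big_split/= [ltRHS](_ : e = e / 2 + e / 2); last by rewrite -splitr.
apply: ltr_leD; first by apply: H => // i; have [] := sP i.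
rewrite sumr_const -[leLHS]mulr_natr -mulrA ler_piMr//; first exact: ltW.
by rewrite mulrC ler_pdivrMr// mul1r ler_nat.
Qed.

Lemma acr_comb f g k l : acr f -> acr g -> acr (fun x => k * f x + l * g x).
Proof.
move=> af ag e e0.
(* One is added because the coefficients may vanish and are divided by. *)
have k0 : 0 < `|k| + 1 by rewrite ltr_wpDl.
have l0 : 0 < `|l| + 1 by rewrite ltr_wpDl.
have [d d0 H] := af _ (divr_gt0 (divr_gt0 e0 (ltr0n R 2)) k0).
have [d' d'0 H'] := ag _ (divr_gt0 (divr_gt0 e0 (ltr0n R 2)) l0).
exists (Num.min d d'); first by rewrite lt_min d0 d'0.
move=> I u v uv tuv; rewrite lt_min => /andP[/(H I u v uv tuv) h /(H' I u v uv tuv) h'].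
apply: (@le_lt_trans _ _ (\sum_i ((`|k| + 1) * `|f (v i) - f (u i)| +
  (`|l| + 1) * `|g (v i) - g (u i)|))).
  apply: ler_sum => i _.
  rewrite (_ : _ - _ = k * (f (v i) - f (u i)) + l * (g (v i) - g (u i))); last by ring.
  rewrite (le_trans (ler_normD _ _))// !normrM lerD// ler_wpM2r// lerDl//.
rewrite big_split/= -!mulr_sumr (_ : e = e / 2 + e / 2); last by rewrite -splitr.
by apply: ltrD; rewrite mulrC -ltr_pdivlMr.
Qed.

(** Jordan decomposition: [f] is the difference of [var_from f] and [var_from f - f], and the second
    is monotone because an increment of [f] is at most the variation. *)
Lemma acr_nondecreasing_var_from f : acr f ->
  (forall x y, a <= x -> x <= y -> y <= b -> var_from f x <= var_from f y) /\
  (forall x y, a <= x -> x <= y -> y <= b -> var_from f x - f x <= var_from f y - f y).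
Proof.
move=> af; split => x y ax xy yb.
  by rewrite -subr_ge0 var_fromB// fine_ge0// total_variation_ge0.
suff : f y - f x <= var_from f y - var_from f x by lra.
rewrite var_fromB//.
have := @total_variation_ge R x y f xy.
rewrite -[X in (_ <= X)%E]fineK; last by apply/bounded_variationP => //; apply: acr_BV.
by rewrite lee_fin; apply: le_trans; exact: ler_norm.
Qed.
End absolute_continuity.

(** * Densities of monotone absolutely continuous functions *)

Section stieltjes.
Context (R : realType) (a b : R).
Local Notation mu := (@lebesgue_measure R).
Local Notation J := (`]a, b[%classic : set R).

(** Projection onto [a, b]: it extends functions to the line by their end values, and pulls back
    covering intervals that stick out of [a, b]. *)
Definition clamp (x : R) := Num.max a (Num.min b x).

Lemma clamp_itv : a <= b -> forall x, a <= clamp x <= b.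
Proof.
move=> ab x; rewrite /clamp le_max lexx /= ge_max ab /=.
by rewrite ge_min lexx.
Qed.

Lemma clamp_id x : a <= x <= b -> clamp x = x.
Proof. by move=> /andP[ax xb]; rewrite /clamp (min_idPr xb) (max_idPr ax). Qed.

Lemma clamp_nondecreasing x y : x <= y -> clamp x <= clamp y.
Proof.
move=> xy; rewrite /clamp ge_max le_max lexx /= le_max; apply/orP; right.
by rewrite le_min !ge_min lexx xy orbT.
Qed.

Lemma clampB x y : x <= y -> clamp y - clamp x <= y - x.
Proof.
move=> xy; rewrite /clamp.
rewrite !maxEle !minEle.
by do ![case: ifPn]; rewrite -?ltNge; lra.
Qed.

(** Ensures that disjoint intervals stay disjoint once their endpoints are clamped. *)
Lemma clamp_lt x z y : clamp x < z -> z < clamp y -> x < z < y.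
Proof.
rewrite /clamp gt_max => /andP[az]; rewrite gt_min => h1.
rewrite lt_max => /orP[|]; first by move/(lt_trans az); rewrite ltxx.
rewrite lt_min => /andP[zb zy]; rewrite zy andbT.
by case/orP: h1 => // /(lt_trans zb); rewrite ltxx.
Qed.

(** Gives the components of an open set of finite measure the endpoints that absolute continuity
    speaks of: finite measure excludes the nonempty unbounded shapes, openness the closed ends. *)
Lemma open_interval_bounded (I : set R) : open I -> is_interval I ->
  (mu I < +oo)%E -> exists2 st : R * R, st.1 <= st.2 & I = `]st.1, st.2[%classic.
Proof.
move=> oI iI; have IE : I = [set` Rhull I] by rewrite RhullK// inE.
have II : I° = I by apply/interior_id.
have emp : I = set0 -> exists2 st : R * R, st.1 <= st.2 & I = `]st.1, st.2[%classic.
  by move=> ->; exists (a, a) => //=; rewrite set_itv_ge// bnd_simp ltxx.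
case: (Rhull I) IE => -[b1 x|[]] [b2 y|[]] IE.
- move=> _; rewrite -II IE interior_itv.
  have [xy|yx] := leP x y; first by exists (x, y).
  by exists (x, x) => //=; rewrite !set_itv_ge ?bnd_simp -?leNgt// ltW.
- by move=> _; apply: emp; rewrite IE set_itv_ge.
- by rewrite IE lebesgue_measure_itv/= ltry.
- by rewrite IE lebesgue_measure_itv/= ltNyr.
- by move=> _; apply: emp; rewrite IE set_itv_ge.
- by rewrite IE lebesgue_measure_itv/=.
- by move=> _; apply: emp; rewrite IE set_itv_ge.
- by move=> _; apply: emp; rewrite IE set_itv_ge.
- by move=> _; apply: emp; rewrite IE set_itv_ge.
Qed.

(* The Stieltjes measure of [F] is absolutely continuous with respect to the
   Lebesgue measure: a null set is covered by an open set of small measure, whose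
   components are the intervals in the definition of absolute continuity. *)
Lemma acr_stieltjes (F : R -> R) : a <= b -> acr a b F ->
  (forall x y, a <= x -> x <= y -> y <= b -> F x <= F y) ->
  exists2 h : R -> R, mu.-integrable setT (EFin \o h) &
    forall x, a <= x <= b -> F x - F a = (\int[mu]_(t in `]a, x]) h t)%R.
Proof.
move=> ab aF ndF.
(* A cumulative function lives on the whole line; this extension adds no mass outside of [a, b]. *)
pose G0 := F \o clamp.
have G0nd : nondecreasing_fun G0.
  move=> x y xy; rewrite /G0/=; have /andP[? ?] := clamp_itv ab x.
  by have /andP[? ?] := clamp_itv ab y; apply: ndF => //; exact: clamp_nondecreasing.
have G0c : right_continuous G0.
  apply: right_continuousW => x; apply/cvgrPdist_lt => e e0.
  have [d d0 H] := acr_uniform_continuous aF e0.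
  near=> y; apply: H; [exact: clamp_itv|exact: clamp_itv|].
  apply: (@le_lt_trans _ _ `|x - y|); last by near: y; apply: cvgr_dist_lt.
  have [xy|/ltW xy] := leP x y.
    rewrite distrC [leRHS]distrC !ger0_norm ?subr_ge0//; last exact: clamp_nondecreasing.
    exact: clampB.
  rewrite !ger0_norm ?subr_ge0//; last exact: clamp_nondecreasing.
  exact: clampB.
pose GM := isCumulative.Build R _ R G0 G0nd G0c.
pose G : cumulative R R := HB.pack G0 GM.
pose nu : {measure set (measurableTypeR R) -> \bar R} := lebesgue_stieltjes_measure G.
have nuE x y : x <= y -> nu `]x, y]%classic = (G0 y - G0 x)%:E.
  move=> xy; rewrite -(wlength_itv_bnd G0 false false xy).
  exact: (measurable_mu_extE (wlength G) (is_ocitv x y)).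
have nu0 (A : set (measurableTypeR R)) : measurable A -> mu A = 0%E -> nu A = 0%E.
  move=> mA A0; apply/eqP; rewrite eq_le measure_ge0 andbT.
  apply/lee_addgt0Pr => e e0; rewrite add0e.
  have [d d0 H] := aF _ e0.
  have Aoo : (mu A < +oo)%E by rewrite A0.
  have [U [oU AU Ud]] := lebesgue_regularity_outer mA Aoo d0.
  have mU : measurable U by exact: measurable_realfun.open_measurable.
  have {}Ud : (mu U < d%:E)%E.
    rewrite (le_lt_trans _ Ud)// -[leRHS]adde0 -A0.
    rewrite -measureU//; last 2 first.
      exact: measurableD.
      by rewrite setDE setIAC -setIA setICr setI0.
    rewrite le_measure ?inE//; first by apply: measurableU => //; exact: measurableD.
    by move=> x Ux; have [Ax|nAx] := pselect (A x); [right|left].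
  pose I := open_disjoint_itv oU.
  have mI q : measurable (I q).
    by apply: measurable_realfun.open_measurable; exact: open_disjoint_itv_open.
  have UE : U = \bigcup_q I q by exact: open_disjoint_itv_bigcup.
  have tI : trivIset setT I by exact: open_disjoint_itv_trivIset.
  have ID q : exists st : R * R, st.1 <= st.2 /\ I q = `]st.1, st.2[%classic.
    have [| | |st ? ?] := @open_interval_bounded (I q).
    - exact: open_disjoint_itv_open.
    - exact: open_disjoint_itv_is_interval.
    - apply: le_lt_trans (lt_trans Ud (ltry _)).
      apply: le_measure; rewrite ?inE; [exact: mI|exact: mU|].
      by rewrite UE; exact: bigcup_sup.
    - by exists st.
  have {ID}[st stP] := choice ID.
  apply: (@le_trans _ _ (nu U)); first by apply: le_measure; rewrite ?inE; [exact: mA|exact: mU|].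
  have -> : nu U = (\sum_(0 <= i <oo) nu (I i))%E.
    by rewrite UE; apply: (measure_semi_bigcup nu);
      [exact: mI|exact: tI|rewrite -UE; exact: mU].
  apply: lime_le; first by apply: is_cvg_nneseries => *; exact: measure_ge0.
  (* It is enough to bound partial sums: finitely many components, clamped to [a, b], form an
     admissible family of total length below [d]. *)
  near=> n.
  apply: (@le_trans _ _ (\sum_(0 <= q < n) (G0 (st q).2 - G0 (st q).1)%:E)).
    apply: lee_sum => q _; have [stq Iq] := stP q; rewrite -nuE//.
      apply: le_measure; rewrite ?inE; [exact: mI|exact: measurable_itv|].
    by rewrite Iq; exact: subset_itv_oo_oc.
  rewrite sumEFin lee_fin big_mkord.
  have := H 'I_n (fun i => clamp (st i).1) (fun i => clamp (st i).2).
  have -> : (\sum_(i < n) `|F (clamp (st i).2) - F (clamp (st i).1)| =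
     \sum_(i < n) (G0 (st i).2 - G0 (st i).1)).
    apply: eq_bigr => i _; rewrite ger0_norm// subr_ge0.
    exact: (G0nd _ _ (stP i).1).
  move=> K; apply/ltW/K.
  - move=> i; have [sti _] := stP i.
    have /andP[? ?] := clamp_itv ab (st i).1.
    have /andP[? ?] := clamp_itv ab (st i).2.
    by split => //; exact: clamp_nondecreasing.
  - move=> i j _ _ [z [/=]]; rewrite !in_itv /= => /andP[z1 z2] /andP[z3 z4].
    apply/val_inj/tI => //; exists z; rewrite (stP i).2 (stP j).2 /= !in_itv /=.
    by split; exact: clamp_lt.
  - rewrite -lte_fin; apply: le_lt_trans Ud.
    apply: (@le_trans _ _ (\sum_(0 <= q < n) mu (I q))).
      rewrite -sumEFin big_mkord; apply: lee_sum => q _; have [stq Iq] := stP q.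
      rewrite Iq lebesgue_measure_itv /= lte_fin; case: ltP => h.
        by rewrite -EFinD lee_fin clampB.
      have -> : (st q).2 = (st q).1 by apply/le_anti; rewrite h stq.
      by rewrite subrr.
    have -> : mu U = (\sum_(0 <= i <oo) mu (I i))%E.
      by rewrite UE; apply: (measure_semi_bigcup mu);
        [exact: mI|exact: tI|rewrite -UE; exact: mU].
    exact: nneseries_lim_ge.
(* The restriction of [nu] to []a, b]] is finite, hence a charge, to which Radon-Nikodym applies. *)
have mab : measurable (`]a, b]%classic : set (measurableTypeR R)) by exact: measurable_itv.
have fab : (nu `]a, b]%classic < +oo)%E by rewrite nuE// ltry.
pose nuf := charge_of_finite_measure (mfrestr mab fab).
have dom : nuf `<< mu.
  apply/null_content_dominatesP => A mA A0.
  rewrite /nuf /charge_of_finite_measure /mfrestr /mrestr; apply: nu0.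
    exact: measurableI.
  apply/eqP; rewrite eq_le measure_ge0 andbT -A0.
  by apply: le_measure; rewrite ?inE//; exact: measurableI.
pose h := Radon_Nikodym nuf mu.
have hE : EFin \o (fine \o h) = h.
  by apply/funext => x /=; rewrite fineK//; exact: Radon_Nikodym_fin_num.
exists (fine \o h); first by rewrite hE; exact: Radon_Nikodym_integrable.
move=> x /andP[ax xb]; rewrite /Rintegral.
under eq_integral => t _ do rewrite fineK ?Radon_Nikodym_fin_num//.
rewrite -Radon_Nikodym_integral//.
transitivity (fine (nu `]a, x]%classic)).
  by rewrite nuE//= /G0/= !clamp_id ?lexx ?ax ?xb.
congr fine; change (nu `]a, x]%classic = nu (`]a, x]%classic `&` `]a, b]%classic)).
by rewrite setIidl//; apply: subset_itvl; rewrite bnd_simp.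
Unshelve. all: by end_near. Qed.
End stieltjes.

(** * Primitives and almost everywhere derivatives *)

Section primitive.
Context (R : realType) (a b : R).
Local Notation mu := (@lebesgue_measure R).
Local Notation J := (`]a, b[%classic : set R).

Definition intJ (h : R -> R) : Prop := mu.-integrable J (EFin \o h).

Definition aeJae (P : R -> Prop) : Prop := {ae mu, forall x, J x -> P x}.

(** Cutting [h] off outside of [J] makes the primitive vanish at [a], while integrating from [-oo]
    matches the form of the fundamental theorem of calculus used in [prim_derive]. *)
Definition prim (h : R -> R) (x : R) : R := (\int[mu]_(t in `]-oo, x]) (h \_ J) t)%R.

(** Carrying the derivative along as a function known almost everywhere turns the handling of
    differential equations into algebra. *)
Definition dac (F h : R -> R) : Prop :=
  acr a b F /\ aeJae (fun x => is_derive x (1 : R) F (h x)).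

Let aeF : Filter (almost_everywhere mu) := ae_filter_ringOfSetsType mu.

Lemma lebesgue_measure_itvoo (u v : R) : u <= v -> mu `]u, v[%classic = (v - u)%:E.
Proof.
rewrite lebesgue_measure_itv/= lte_fin le_eqVlt => /predU1P[->|->]; last by rewrite -EFinD.
by rewrite ltxx subrr.
Qed.

Lemma aeJ_imp (P S : R -> Prop) : (forall x, a < x < b -> P x -> S x) ->
  aeJae P -> aeJae S.
Proof.
rewrite /aeJae => PS; apply: filterS; first exact: aeF.
move=> x PJ Jx; apply: PS; last exact: PJ.
by move: Jx; rewrite /= in_itv.
Qed.

Lemma aeJ_imp2 (P S T : R -> Prop) : (forall x, a < x < b -> P x -> S x -> T x) ->
  aeJae P -> aeJae S -> aeJae T.
Proof.
rewrite /aeJae => PS; apply: filterS2; first exact: aeF.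
move=> x PJ SJ Jx; apply: PS; [|exact: PJ|exact: SJ].
by move: Jx; rewrite /= in_itv.
Qed.

Lemma aeJ_imp3 (P S T U : R -> Prop) : (forall x, a < x < b -> P x -> S x -> T x -> U x) ->
  aeJae P -> aeJae S -> aeJae T -> aeJae U.
Proof.
rewrite /aeJae => PS; apply: filterS3; first exact: aeF.
move=> x PJ SJ TJ Jx; apply: PS; [|exact: PJ|exact: SJ|exact: TJ].
by move: Jx; rewrite /= in_itv.
Qed.

Lemma aeJ_all (P : R -> Prop) : (forall x, a < x < b -> P x) -> aeJae P.
Proof. by move=> PS; apply: aeW => x; rewrite /= in_itv/=; exact: PS. Qed.

Lemma intJ_restrict h : intJ h -> mu.-integrable setT (EFin \o (h \_ J)).
Proof.
move=> ih; rewrite -restrict_EFin; apply/integrable_restrict => //.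
by rewrite setTI.
Qed.

Lemma intJ_lin f g k l : intJ f -> intJ g -> intJ (fun x => k * f x + l * g x).
Proof.
move=> hf hg; rewrite /intJ.
have mJ : measurable (J : set (measurableTypeR R)) by exact: measurable_itv.
have := integrableD mJ (integrableZl mJ k hf) (integrableZl mJ l hg).
by apply: eq_integrable => // x _; rewrite /= EFinD !EFinM.
Qed.

Lemma intJ_eq f g : (forall x, a < x < b -> f x = g x) -> intJ f -> intJ g.
Proof.
move=> fg; apply: eq_integrable => // x; rewrite inE /= in_itv /= => /fg ->.
by [].
Qed.

Lemma intJ_cst k : intJ (fun=> k).
Proof.
apply: measurable_bounded_integrable => //; last exact: bounded_cst.
have h : (mu J < +oo)%E.
  by rewrite lebesgue_measure_itv/=; case: ifP => _; rewrite ?ltry// -EFinD ltry.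
exact: h.
Qed.

Lemma intJ_abs f : intJ f -> intJ (fun x => `|f x|).
Proof. by move=> ?; exact: integrable_norm. Qed.

Lemma intJM f (h : R -> R) (M : R) : intJ f -> measurable_fun J h ->
  (forall x, a < x < b -> `|h x| <= M) -> intJ (fun x => h x * f x).
Proof.
move=> hf mh hM.
have bh : [bounded h x | x in J].
  exists M; split; first exact: num_real.
  move=> N MN x; rewrite /= in_itv /= => /hM h1; exact/(le_trans h1)/ltW.
have := @integrableMr _ _ _ mu _ (measurable_itv `]a, b[) h (EFin \o f) mh bh hf.
by apply: eq_integrable => // x _; rewrite /= EFinM.
Qed.

Lemma primE h x : prim h x = (\int[mu]_(t in `]-oo, x] `&` J) h t)%R.
Proof. by rewrite Rintegral_mkcondr. Qed.

Lemma prim_left h : prim h a = 0.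
Proof.
rewrite primE (_ : _ `&` _ = set0) ?Rintegral_set0//.
apply/seteqP; split => x //= []; rewrite !in_itv /= => xa /andP[ax _].
by have := lt_le_trans ax xa; rewrite ltxx.
Qed.

Lemma primB h x y : intJ h -> x <= y ->
  prim h y - prim h x = (\int[mu]_(t in `]x, y]) (h \_ J) t)%R.
Proof.
move=> /intJ_restrict ih xy; rewrite /prim Rintegral_itvB//.
by apply: integrableS ih.
Qed.

Lemma prim_itv h x : intJ h -> a <= x <= b -> prim h x = (\int[mu]_(t in `]a, x]) h t)%R.
Proof.
move=> ih /andP[ax xb].
have ihx : mu.-integrable `]a, x[ (EFin \o h).
  by apply: integrableS ih => //; apply: subset_itvl; rewrite bnd_simp.
rewrite -Rintegral_itv_bndo_bndc// -[LHS]subr0 -(prim_left h) primB//.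
rewrite -Rintegral_itv_bndo_bndc; last first.
  by apply: integrableS (intJ_restrict ih).
apply: eq_Rintegral => t; rewrite inE /= in_itv /= => /andP[ta tx].
by rewrite patchE mem_set//= in_itv /= ta (lt_le_trans tx).
Qed.

(** Absolute continuity of the integral, applied to the union of the intervals, whose measure is
    their total length. *)
Lemma acr_prim h : intJ h -> acr a b (prim h).
Proof.
move=> ih e e0; have ihT := intJ_restrict ih.
have [d [d0 H]] := integral_normr_continuous ihT e0.
exists d => // I u v uv tuv sd.
pose D := \big[setU/set0]_(i : I) (`]u i, v i[%classic : set R).
have mD : measurable D by apply: bigsetU_measurable => i _; exact: measurable_itv.
have mi i : measurable (`]u i, v i[%classic : set R) by exact: measurable_itv.
have tuv' : trivIset [set` index_enum I] (fun i => `]u i, v i[%classic).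
  by move=> i j _ _; exact: tuv.
have muD : (mu D < d%:E)%E.
  have -> : mu D = (\int[mu]_(x in D) (cst 1%E) x)%E by rewrite integral_cst// mul1e.
  rewrite (@ge0_integral_bigsetU _ _ R mu I (fun i => `]u i, v i[%classic) (cst 1%E)
    (index_enum I) mi (index_enum_uniq I) tuv')//.
  apply: (@le_lt_trans _ _ (\sum_i (v i - u i))%:E); last by rewrite lte_fin.
  rewrite -sumEFin; apply: lee_sum => i _; rewrite integral_cst// mul1e.
    rewrite le_eqVlt; apply/orP; left; apply/eqP; apply: lebesgue_measure_itvoo.
  by have [] := uv i.
have gD : mu.-integrable D (EFin \o (h \_ J)) by apply: integrableS ihT.
rewrite -lte_fin; apply: (@le_lt_trans _ _ (\int[mu]_(x in D) `|(h \_ J) x|%:E)%E).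
  rewrite -sumEFin (@ge0_integral_bigsetU _ _ R mu I (fun i => `]u i, v i[%classic)
    (fun x => `|(h \_ J) x|%:E) (index_enum I) mi (index_enum_uniq I) tuv'); last 2 first.
  - by case/integrableP : (integrable_norm gD).
  - by move=> x _; rewrite lee_fin.
  apply: lee_sum => i _; have [_ uvi _] := uv i.
  have gi : mu.-integrable `]u i, v i[ (EFin \o (h \_ J)) by apply: integrableS ihT.
  rewrite primB// -Rintegral_itv_bndo_bndc// EFin_normr_Rintegral//.
  apply: (le_trans (le_abse_integral mu (mi i) _)); first by case/integrableP : gi.
  by under eq_integral do rewrite abse_EFin.
have := H D mD muD; rewrite -lte_fin /Rintegral fineK//.
by apply: integrable_fin_num => //; exact: integrable_norm gD.
Qed.
Lemma prim_derive h : intJ h -> aeJae (fun x => is_derive x (1 : R) (prim h) (h x)).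
Proof.
move=> ih; have ihT := intJ_restrict ih.
have := @FTC1Ny R (h \_ J).
have i1 y : mu.-integrable `]-oo, y] (EFin \o (h \_ J)) by apply: integrableS ihT.
have i2 : locally_integrable [set: R] (h \_ J) by exact: integrable_locally.
move=> /(_ i1 i2); apply: filterS; first exact: aeF. move=> x [/= dF vF] Jx.
split; first exact: dF.
rewrite -derive1E [LHS]vF patchE mem_set//.
Qed.

Lemma dac_prim h : intJ h -> dac (prim h) h.
Proof. by move=> ih; split; [exact: acr_prim|exact: prim_derive]. Qed.

(** The density is the difference of those that [acr_stieltjes] gives for the two monotone functions
    of the Jordan decomposition. *)
Lemma acr_primitive F : a <= b -> acr a b F ->
  exists2 h, intJ h & forall x, a <= x <= b -> F x = F a + prim h x.
Proof.
move=> ab aF; have [V1 V2] := acr_nondecreasing_var_from aF.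
have aV := acr_var_from aF.
have aVF : acr a b (fun x => var_from a F x - F x).
  by have := acr_comb 1 (-1) aV aF; under eq_fun do rewrite mul1r mulN1r.
have [h1 i1 E1] := acr_stieltjes ab aV V1.
have [h2 i2 E2] := acr_stieltjes ab aVF V2.
have j1 : intJ h1 by apply: integrableS i1.
have j2 : intJ h2 by apply: integrableS i2.
have i12 : intJ (fun x => h1 x - h2 x).
  by have := intJ_lin 1 (-1) j1 j2; apply: intJ_eq => x _; rewrite mul1r mulN1r.
exists (fun x => h1 x - h2 x) => // x xab; rewrite prim_itv// RintegralB//; last 2 first.
- by apply: integrableS i1.
- by apply: integrableS i2.
rewrite -E1// -E2//; ring.
Qed.

Lemma acr_derive F : a <= b -> acr a b F -> exists h,
  [/\ intJ h, dac F h & forall x, a <= x <= b -> F x = F a + prim h x].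
Proof.
move=> ab aF; have [h ih hE] := acr_primitive ab aF; exists h; split => //; split => //.
apply: aeJ_imp (prim_derive ih) => x /andP[ax xb] dx.
have d1 : is_derive x 1 (cst (F a) + prim h) (0 + h x) by apply: is_deriveD.
rewrite add0r in d1.
apply: near_eq_is_derive d1.
have := @near_in_itvoo R a b x; rewrite in_itv /= ax xb => /(_ isT).
apply: filterS => t; rewrite in_itv /= => /andP[ta tb].
by rewrite (hE t)// (ltW ta) (ltW tb).
Qed.

Lemma is_derive_unique (F : R -> R) (x h k : R) :
  is_derive x 1 F h -> is_derive x 1 F k -> h = k.
Proof. by move=> [_ <-] [_ <-]. Qed.

(** [F] is the primitive of some integrable [g], and uniqueness of derivatives gives [g = h] almost
    everywhere, so increments of [F] are integrals of a nonnegative function. *)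
Lemma dac_nondecreasing F h : a <= b -> dac F h -> aeJae (fun x => 0 <= h x) ->
  forall x y, a <= x -> x <= y -> y <= b -> F x <= F y.
Proof.
move=> ab [aF dF] h0 x y ax xy yb; have [g [ig [_ dg] gE]] := acr_derive ab aF.
have xab : a <= x <= b by rewrite ax (le_trans xy yb).
have yab : a <= y <= b by rewrite yb (le_trans ax xy).
rewrite (gE x xab) (gE y yab) lerD2l -subr_ge0 primB// /Rintegral.
have ige := intJ_restrict ig.
have igxy : mu.-integrable `]x, y] (EFin \o g \_ J) by apply: integrableS ige.
(* The integrand is replaced by its absolute value, which is nonnegative at every point. *)
rewrite (@ae_eq_integral _ _ _ mu _ (fun t => (`|(g \_ J) t|)%:E)) //; last 3 first.
- by case/integrableP : igxy.
- by case/integrableP: (integrable_norm igxy).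
- move: dF dg h0; rewrite /aeJae => dF dg h0.
  apply: filterS3 dF dg h0; first exact: aeF. 
  move=> t /= dF dg h0 _; rewrite patchE.
  case: ifPn => [|]; last by rewrite normr0.
  rewrite inE => Jt; rewrite ger0_norm//.
  by rewrite -(is_derive_unique (dF Jt) (dg Jt)); exact: h0.
by rewrite fine_ge0// integral_ge0.
Qed.

Lemma dac_lin F f G g k l : dac F f -> dac G g ->
  dac (fun x => k * F x + l * G x) (fun x => k * f x + l * g x).
Proof.
move=> [aF dF] [aG dG]; split; first exact: acr_comb.
apply: aeJ_imp2 dF dG => x _ dF dG.
have := is_deriveD (is_deriveZ k dF) (is_deriveZ l dG).
exact.
Qed.

Lemma dac_ext F f g : dac F f -> aeJae (fun x => f x = g x) -> dac F g.
Proof.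
by move=> [aF dF] fg; split => //; apply: aeJ_imp2 dF fg => x _ + <-.
Qed.

Lemma dac_add F f G g : dac F f -> dac G g ->
  dac (fun x => F x + G x) (fun x => f x + g x).
Proof.
move=> dF dG; have := dac_lin 1 1 dF dG.
by under eq_fun do rewrite !mul1r; under [X in dac _ X]eq_fun do rewrite !mul1r.
Qed.

Lemma dac_sub F f G g : dac F f -> dac G g ->
  dac (fun x => F x - G x) (fun x => f x - g x).
Proof.
move=> dF dG; have := dac_lin 1 (-1) dF dG.
by under eq_fun do rewrite mul1r mulN1r; under [X in dac _ X]eq_fun do rewrite mul1r mulN1r.
Qed.

Lemma dac_scale F f k : dac F f -> dac (fun x => k * F x) (fun x => k * f x).
Proof.
move=> dF; have := dac_lin k 0 dF dF.
by under eq_fun do rewrite mul0r addr0; under [X in dac _ X]eq_fun do rewrite mul0r addr0.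
Qed.

Lemma acr_eq F G : (forall x, a <= x <= b -> F x = G x) -> acr a b F -> acr a b G.
Proof.
move=> FG aF e /aF[d d0 H]; exists d => // I u v uv tuv /(H I u v uv tuv).
rewrite (eq_bigr (fun i => `|G (v i) - G (u i)|))// => i _.
have [ui uvi vi] := uv i; rewrite !FG//; apply/andP; split => //.
  exact: le_trans vi.
exact: le_trans uvi.
Qed.

Lemma dac_eq F G f : (forall x, a <= x <= b -> F x = G x) -> dac F f -> dac G f.
Proof.
move=> FG [aF dF]; split; first exact: acr_eq aF.
apply: aeJ_imp dF => x /andP[ax xb]; apply: near_eq_is_derive.
have := @near_in_itvoo R a b x; rewrite in_itv /= ax xb => /(_ isT).
apply: filterS => t; rewrite in_itv /= => /andP[ta tb].
by rewrite FG ?ltW.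
Qed.

(** Both [G + F] and [G - F] are nondecreasing. This plays the part of the estimate of an integral
    by that of a dominating function. *)
Lemma dac_compare F f G g : a <= b -> dac F f -> dac G g ->
  aeJae (fun x => `|f x| <= g x) ->
  forall x, a <= x <= b -> `|F x - F a| <= G x - G a.
Proof.
move=> ab dF dG fg x /andP[ax xb].
have h1 := dac_nondecreasing ab (dac_lin 1 1 dG dF).
have h2 := dac_nondecreasing ab (dac_lin 1 (-1) dG dF).
rewrite ler_norml; apply/andP; split.
  have := h1 _ a x; rewrite lexx !mul1r => /(_ _ isT ax xb); rewrite -subr_ge0.
  suff hh : aeJae (fun x0 => 0 <= 1 * g x0 + 1 * f x0) by move=> /(_ hh); lra.
  by apply: aeJ_imp fg => t _; rewrite ler_norml => /andP[]; lra.
have := h2 _ a x; rewrite lexx !mul1r => /(_ _ isT ax xb); rewrite -subr_ge0.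
suff hh : aeJae (fun x0 => 0 <= 1 * g x0 + -1 * f x0) by move=> /(_ hh); lra.
by apply: aeJ_imp fg => t _; rewrite ler_norml => /andP[]; lra.
Qed.

Lemma acr_cst k : acr a b (fun=> k).
Proof.
move=> e e0; exists 1 => // I u v _ _ _.
by rewrite big1// => i _; rewrite subrr normr0.
Qed.

Lemma dac_cst k : dac (fun=> k) (fun=> 0).
Proof. by split; [exact: acr_cst|apply: aeJ_all => x _; exact: is_derive_cst]. Qed.

Lemma dac_const F f : a <= b -> dac F f -> aeJae (fun x => f x = 0) ->
  forall x, a <= x <= b -> F x = F a.
Proof.
move=> ab dF f0 x xab; have := dac_compare ab dF (dac_cst 0) _ xab.
rewrite subrr normr_le0 subr_eq0 => h; apply/eqP/h.
by apply: aeJ_imp f0 => t _ ->; rewrite normr0.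
Qed.

(** Each of the two monotone functions of the Jordan decomposition is bounded by its end values. *)
Lemma acr_bounded F : acr a b F -> exists2 M : R, 0 <= M &
  forall x, a <= x <= b -> `|F x| <= M.
Proof.
move=> aF; have [V1 V2] := acr_nondecreasing_var_from aF.
pose W x := var_from a F x.
exists (`|W a| + `|W b| + `|W b - F b| + `|W a - F a|); first by rewrite !addr_ge0.
move=> x /andP[ax xb].
have := V1 _ _ (lexx a) ax xb; have := V1 _ _ ax xb (lexx b).
have := V2 _ _ (lexx a) ax xb; have := V2 _ _ ax xb (lexx b).
rewrite -/(W a) -/(W b) -/(W x) => h1 h2 h3 h4; rewrite ler_norml.
have := ler_norm (W b - F b); have := lerNnormlW (lexx `|W a - F a|).
have := ler_norm (W b); have := lerNnormlW (lexx `|W a|).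
have := ler_norm (W a); have := lerNnormlW (lexx `|W b|).
have := normr_ge0 (W a); have := normr_ge0 (W b).
have := normr_ge0 (W a - F a); have := normr_ge0 (W b - F b).
by move=> *; apply/andP; split; lra.
Qed.

Lemma acr_measurable F : acr a b F -> measurable_fun J F.
Proof.
move=> aF; apply: measurable_realfun.open_continuous_measurable_fun; first exact: interval_open.
move=> x; rewrite inE /= in_itv /= => /andP[ax xb]; apply/cvgrPdist_lt => e e0.
have [d d0 H] := acr_uniform_continuous aF e0.
have := @near_in_itvoo R a b x; rewrite in_itv /= ax xb => /(_ isT) => nx.
near=> t; apply: H; first by rewrite !ltW.
  have : t \in `]a, b[ by near: t.
  by rewrite in_itv /= => /andP[? ?]; rewrite !ltW.
by near: t; apply: cvgr_dist_lt.
Unshelve. all: by end_near. Qed.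

Lemma acr_mul F G : acr a b F -> acr a b G -> acr a b (fun x => F x * G x).
Proof.
move=> aF aG; have [M M0 MF] := acr_bounded aF; have [N N0 NG] := acr_bounded aG.
move=> e e0.
have N1 : 0 < N + 1 by rewrite ltr_wpDl.
have M1 : 0 < M + 1 by rewrite ltr_wpDl.
have [d d0 H] := aF _ (divr_gt0 (divr_gt0 e0 (ltr0n R 2)) N1).
have [d' d'0 H'] := aG _ (divr_gt0 (divr_gt0 e0 (ltr0n R 2)) M1).
exists (Num.min d d'); first by rewrite lt_min d0 d'0.
move=> I u v uv tuv; rewrite lt_min => /andP[/(H I u v uv tuv) h /(H' I u v uv tuv) h'].
apply: (@le_lt_trans _ _ (\sum_i ((N + 1) * `|F (v i) - F (u i)| +
  (M + 1) * `|G (v i) - G (u i)|))).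
  apply: ler_sum => i _; have [ua uvi vb] := uv i.
  have uab : a <= u i <= b by rewrite ua (le_trans uvi).
  have vab : a <= v i <= b by rewrite vb (le_trans ua).
  rewrite (_ : _ - _ = G (v i) * (F (v i) - F (u i)) + F (u i) * (G (v i) - G (u i))); last by ring.
  rewrite (le_trans (ler_normD _ _))// !normrM lerD// ler_wpM2r//.
    by rewrite (le_trans (NG _ vab))// lerDl.
  by rewrite (le_trans (MF _ uab))// lerDl.
rewrite big_split/= -!mulr_sumr (_ : e = e / 2 + e / 2); last by rewrite -splitr.
by apply: ltrD; rewrite mulrC -ltr_pdivlMr.
Qed.

Lemma dac_mul F f G g : dac F f -> dac G g ->
  dac (fun x => F x * G x) (fun x => F x * g x + G x * f x).
Proof.
move=> [aF dF] [aG dG]; split; first exact: acr_mul.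
by apply: aeJ_imp2 dF dG => x _ dF dG; exact: is_deriveM.
Qed.

Lemma intJ_acrM f F : intJ f -> acr a b F -> intJ (fun x => F x * f x).
Proof.
move=> hf aF; have [M M0 MF] := acr_bounded aF.
apply: (intJM hf (acr_measurable aF) (M := M)) => x /andP[ax xb].
by apply: MF; rewrite !ltW.
Qed.

Lemma acr_intJ F : acr a b F -> intJ F.
Proof.
by move=> aF; have := intJ_acrM (intJ_cst 1) aF; apply: intJ_eq => x _; rewrite mulr1.
Qed.

(** By continuity, a nonzero value at [x] excludes zeros near [x], hence on an interval of positive
    length inside [J]. Endpoints are included, as boundary values require; there [a < b] keeps this
    interval nonempty. *)
Lemma acr_ae0 F : a < b -> acr a b F -> aeJae (fun x => F x = 0) ->
  forall x, a <= x <= b -> F x = 0.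
Proof.
move=> ab aF F0 x /andP[ax xb]; apply/eqP/negP => /negP nF.
have e0 : 0 < `|F x| by rewrite normr_gt0.
have [d d0 H] := acr_uniform_continuous aF e0.
pose u := Num.max a (x - d); pose v := Num.min b (x + d).
have uv : u < v.
  by rewrite /u /v gt_max !lt_min ab /=; apply/andP; split; [lra|apply/andP; split; lra].
case: F0 => N [mN N0 FN].
have : (mu `]u, v[%classic <= mu N)%E.
  apply: le_measure; rewrite ?inE//.
  move=> z; rewrite /= in_itv /= /u /v gt_max lt_min => /andP[/andP[az xz] /andP[zb zx]].
  apply: FN => /=; rewrite in_itv /= az zb => /(_ isT) Fz.
  have := H x z; rewrite ax xb !ltW// Fz subr0 ltxx => /(_ isT isT) h.
  have : `|x - z| < d by rewrite ltr_norml; apply/andP; split; lra.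
  by move/h.
by rewrite N0 lebesgue_measure_itv /= lte_fin uv -EFinD lee_fin subr_le0 leNgt uv.
Qed.

Lemma dac_expR F f : dac F f -> dac (fun x => expR (F x)) (fun x => expR (F x) * f x).
Proof.
move=> [aF dF]; split; last first.
  by apply: aeJ_imp dF => x _ dF; exact: (is_derive1_comp (is_derive_expR (F x)) dF).
have [M M0 MF] := acr_bounded aF.
(* On the range of [F] the exponential is Lipschitz with constant [expR M], by the convexity
   inequality [1 + s <= expR s]. *)
have lip x y : a <= x <= b -> a <= y <= b -> expR (F x) - expR (F y) <= expR M * `|F x - F y|.
  move=> xab yab; apply: (@le_trans _ _ (expR (F x) * (F x - F y))).
    have := expR_ge1Dx (F y - F x) => h.
    have := ler_wpM2l (expR_ge0 (F x)) h.
    have -> : expR (F x) * expR (F y - F x) = expR (F y).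
      by rewrite -expRD; congr expR; ring.
    by move=> h2; nra.
  apply: (@le_trans _ _ (expR (F x) * `|F x - F y|)).
    by rewrite ler_wpM2l ?expR_ge0// ler_norm.
  by rewrite ler_wpM2r// ler_expR (le_trans (ler_norm _))// MF.
move=> e e0; have [d d0 H] := aF _ (divr_gt0 e0 (expR_gt0 M)).
exists d => // I u v uv tuv sd.
apply: (@le_lt_trans _ _ (\sum_i expR M * `|F (v i) - F (u i)|)).
  apply: ler_sum => i _; have [ua uvi vb] := uv i.
  have uab : a <= u i <= b by rewrite ua (le_trans uvi).
  have vab : a <= v i <= b by rewrite vb (le_trans ua).
  rewrite ler_norml; apply/andP; split; last exact: lip.
  by have := lip _ _ uab vab; rewrite distrC; lra.
by rewrite -mulr_sumr mulrC -ltr_pdivlMr ?expR_gt0//; exact: H.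
Qed.
End primitive.

(** * Linear differential systems with integrable coefficients *)

Section geometric.
Context (R : realType).

Lemma geometric_eq0 (z c : R) : (forall n, `|z| <= c * 2^-1 ^+ n) -> z = 0.
Proof.
move=> H; apply/eqP/negP => /negP z0.
have zp : 0 < `|z| by rewrite normr_gt0.
have h2 : `|2^-1 : R| < 1 by rewrite ger0_norm ?invr_ge0// invf_lt1 ?ltr1n.
have : c * 2^-1 ^+ n @[n --> \oo] --> c * 0 by apply: cvgM; [exact: cvg_cst|exact: cvg_expr].
rewrite mulr0 => /cvgrPdist_lt/(_ _ zp)[n _ /(_ n (leqnn n))] /=.
rewrite sub0r normrN => h.
by have := le_lt_trans (le_trans (H n) (ler_norm _)) h; rewrite ltxx.
Qed.

(** The intervals of center [u n] and radius [r n], the tail of the geometric series, are nested;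
    the limit is the supremum of their left ends. *)
Lemma geometric_limit (u : nat -> R) (K : R) :
  (forall n, `|u n.+1 - u n| <= K * 2^-1 ^+ n) ->
  exists l, forall n, `|l - u n| <= 2 * K * 2^-1 ^+ n.
Proof.
move=> H; pose r n := 2 * K * 2^-1 ^+ n.
have rS n : r n - r n.+1 = K * 2^-1 ^+ n by rewrite /r exprS; field.
have K0 : 0 <= K by have := le_trans (normr_ge0 _) (H 0%N); rewrite expr0 mulr1.
have r0 n : 0 <= r n by rewrite /r !mulr_ge0// exprn_ge0// invr_ge0.
have Lnd : nondecreasing_seq (fun n => u n - r n).
  apply/nondecreasing_seqP => n; have := H n; rewrite -rS ler_norml => /andP[? ?]; lra.
have Uni : nonincreasing_seq (fun n => u n + r n).
  apply/nonincreasing_seqP => n; have := H n; rewrite -rS ler_norml => /andP[? ?]; lra.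
have LU m n : u m - r m <= u n + r n.
  apply: (le_trans (Lnd _ _ (leq_maxl m n))); apply: le_trans (Uni _ _ (leq_maxr m n)).
  by have := r0 (maxn m n); lra.
pose S := [set u n - r n | n in [set: nat]].
have hS : has_sup S.
  split; first by exists (u 0%N - r 0%N), 0%N.
  by exists (u 0%N + r 0%N) => _ [m _ <-]; exact: LU.
exists (sup S) => n; rewrite ler_distlC -/(r n); apply/andP; split.
  by rewrite lerBlDr; apply: ge_sup; [case: hS|move=> _ [m _ <-]; exact: LU].
by rewrite -lerBlDr; apply: ub_le_sup; [case: hS|exists n].
Qed.
End geometric.

Section linear_ode.
Context (R : realType) (a b : R).
Local Notation mu := (@lebesgue_measure R).
Local Notation J := (`]a, b[%classic : set R).

Lemma intJ_sum (I : finType) (f : I -> R -> R) : (forall i, intJ a b (f i)) ->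
  intJ a b (fun x => \sum_i f i x).
Proof.
move=> hf; elim: (index_enum I) => [|i s IH].
  by apply: intJ_eq (intJ_cst a b 0) => x _; rewrite big_nil.
by have := intJ_lin 1 1 (hf i) IH; apply: intJ_eq => x _; rewrite big_cons !mul1r.
Qed.

Lemma dac_addc F f k : dac a b F f -> dac a b (fun x => k + F x) f.
Proof.
move=> dF; have := dac_lin 1 1 (dac_cst a b k) dF.
by under eq_fun do rewrite !mul1r; under [X in dac _ _ _ X]eq_fun do rewrite mulr0 add0r mul1r.
Qed.

Lemma linear_ode_exists (I : finType) (A : I -> I -> R -> R) (y0 : I -> R) :
  a <= b -> (forall i j, intJ a b (A i j)) ->
  exists Y : I -> R -> R, forall i,
    dac a b (Y i) (fun x => \sum_j A i j x * Y j x) /\ Y i a = y0 i.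
Proof.
move=> ab iA.
have aab : a <= a <= b by rewrite lexx ab.
have bab : a <= b <= b by rewrite lexx ab.
pose rhs (Y : I -> R -> R) i t := \sum_j A i j t * Y j t.
pose step (Y : I -> R -> R) i x := y0 i + prim a b (rhs Y i) x.
have int_rhs Y i : (forall j, acr a b (Y j)) -> intJ a b (rhs Y i).
  move=> aY; apply: intJ_sum => j; have := intJ_acrM (iA i j) (aY j).
  by apply: intJ_eq => x _; rewrite mulrC.
have [Yn [aYn dYn Yna Yn0]] : exists Yn : nat -> I -> R -> R,
    [/\ forall n i, acr a b (Yn n i),
        forall n i, dac a b (Yn n.+1 i) (rhs (Yn n) i),
        forall n i, Yn n i a = y0 i & forall i x, Yn 0%N i x = y0 i].
  pose Yn n := iter n step (fun i _ => y0 i).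
  have aYn n i : acr a b (Yn n i).
    elim: n i => [|n IH] i; first exact: acr_cst.
    by have [] := dac_addc (y0 i) (dac_prim (int_rhs _ i IH)).
  exists Yn; split => //.
    by move=> n i; exact: dac_addc (dac_prim (int_rhs _ i (aYn n))).
  by case=> // n i; rewrite /Yn /= /step prim_left addr0.
(* The sum of all entries dominates every row, so one weight serves all components. *)
pose h t := \sum_i \sum_j `|A i j t|.
have h0 t : 0 <= h t by apply: sumr_ge0 => i _; apply: sumr_ge0.
have ih : intJ a b h by apply: intJ_sum => i; apply: intJ_sum => j; exact: intJ_abs.
have hA i t : \sum_j `|A i j t| <= h t.
  rewrite /h [leRHS](bigD1 i)//= lerDl; apply: sumr_ge0 => k _; exact: sumr_ge0.
pose H := prim a b h.
have dH : dac a b H h by exact: dac_prim.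
have Ha : H a = 0 by exact: prim_left.
have Hnd : forall x y, a <= x -> x <= y -> y <= b -> H x <= H y.
  by apply: (dac_nondecreasing ab dH); apply: aeJ_all.
(* In the norm weighted by [1 / E] the Picard iteration contracts by [1/2]. *)
pose E x := expR (2 * H x).
have dE : dac a b E (fun x => E x * (2 * h x)).
  exact: dac_expR (dac_scale 2 dH).
have E1 x : a <= x <= b -> 1 <= E x.
  move=> /andP[ax xb]; rewrite /E -[leLHS]expR0 ler_expR mulr_ge0//.
  by rewrite -Ha; exact: Hnd.
have EE x : a <= x <= b -> E x <= E b.
  by move=> /andP[ax xb]; rewrite /E ler_expR ler_pM2l//; exact: Hnd.
have /choice[M0 M0P] : forall i, exists M : R, forall x, a <= x <= b -> `|Yn 1 i x - Yn 0 i x| <= M.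
  move=> i; have := acr_comb 1 (-1) (aYn 1 i) (aYn 0 i).
  move=> /acr_bounded[M _ MP]; exists M => x /MP.
  by rewrite mul1r mulN1r.
pose C := \sum_i `|M0 i|.
have C0 : 0 <= C by exact: sumr_ge0.
have bound n i x : a <= x <= b -> `|Yn n.+1 i x - Yn n i x| <= C * 2^-1 ^+ n * E x.
  elim: n i x => [|n IH] i x xab.
    rewrite expr0 mulr1 (le_trans (M0P i x xab))// (le_trans (ler_norm _))//.
    rewrite (@le_trans _ _ C)//; last by rewrite ler_peMr// E1.
    by rewrite /C (bigD1 i)//= lerDl sumr_ge0.
    have dF := dac_sub (dYn n.+1 i) (dYn n i).
  (* The derivative of [c * E] is [h] times the previous bound: the factor 2 in the exponent of [E]
     pays for halving the constant. *)
  pose c := C * 2^-1 ^+ n.+1.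
  have c0 : 0 <= c by rewrite mulr_ge0// exprn_ge0// invr_ge0.
    have dG := dac_scale c dE.
  have := dac_compare ab dF dG _ xab.
  rewrite (Yna n.+2) (Yna n.+1) subrr subr0 => cmp.
  apply: le_trans (cmp _) _; last first.
    by rewrite gerBl mulr_ge0// (le_trans ler01)// E1.
    apply: aeJ_all => t /andP[/ltW ta /ltW tb].
  rewrite /rhs -sumrB; apply: (le_trans (ler_norm_sum _ _ _)).
  apply: (@le_trans _ _ (\sum_j `|A i j t| * (C * 2^-1 ^+ n * E t))).
    apply: ler_sum => j _; rewrite -mulrBr normrM ler_wpM2l//.
    by apply: IH; rewrite ta tb.
  rewrite -mulr_suml.
  have -> : c * (E t * (2 * h t)) = h t * (C * 2^-1 ^+ n * E t).
    by rewrite /c exprS; field.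
  rewrite ler_wpM2r// mulr_ge0//; first by rewrite mulr_ge0// exprn_ge0// invr_ge0.
  by rewrite (le_trans ler01)// E1// ta tb.
pose K := C * E b.
have K0 : 0 <= K by rewrite mulr_ge0// (le_trans ler01)// E1.
have /choice[Y YP] : forall i, exists Yi : R -> R, forall x, a <= x <= b ->
    forall n, `|Yi x - Yn n i x| <= 2 * K * 2^-1 ^+ n.
    move=> i; suff /choice[Yi YiP] : forall x, exists l, a <= x <= b ->
      forall n, `|l - Yn n i x| <= 2 * K * 2^-1 ^+ n by exists Yi.
  move=> x.
  have [xab|nxab] := boolP (a <= x <= b); last by exists 0.
  have [n|l lP] := @geometric_limit R (fun n => Yn n i x) K; last by exists l.
    apply: (le_trans (bound n i x xab)); rewrite /K mulrAC.
  apply: ler_wpM2r; first by rewrite exprn_ge0// invr_ge0.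
  by apply: ler_wpM2l; last exact: EE.
have Jab x : J x -> a <= x <= b.
  by rewrite /= in_itv /= => /andP[? ?]; rewrite !ltW.
have Jab' x : a < x < b -> a <= x <= b by move=> /andP[? ?]; rewrite !ltW.
(* The limit [Y] is so far only a pointwise limit; measurability and boundedness make the right-hand
   side integrable. *)
have mY i : measurable_fun J (Y i).
  apply: (measurable_realfun.measurable_fun_cvg (h := fun n => Yn n i)).
    by move=> n; exact: acr_measurable.
  move=> x /Jab xab; apply/cvgrPdist_lt => e e0.
  have h2 : `|2^-1 : R| < 1 by rewrite ger0_norm ?invr_ge0// invf_lt1 ?ltr1n.
  have : 2 * K * 2^-1 ^+ n @[n --> \oo] --> 2 * K * 0.
    by apply: cvgM; [exact: cvg_cst|exact: cvg_expr].
  rewrite mulr0 => /cvgrPdist_lt/(_ _ e0); apply: filterS => n.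
  rewrite sub0r normrN => hn; apply: le_lt_trans hn.
  by rewrite (le_trans (YP i x xab n))// ler_norm.
have /choice[M MP] : forall i, exists M : R, forall x, a < x < b -> `|Y i x| <= M.
  move=> i; exists (`|y0 i| + 2 * K) => x /Jab' xab.
    have := YP i x xab 0%N; rewrite expr0 mulr1 Yn0 => hh.
  by rewrite -[Y i x](subrK (y0 i)) addrC (le_trans (ler_normD _ _))// lerD2l.
have iY i : intJ a b (rhs Y i).
  apply: intJ_sum => j; have := intJM (iA i j) (mY j) (MP j).
  by apply: intJ_eq => x _; rewrite mulrC.
(* One more Picard step is absolutely continuous by construction; it remains to see that it does not
   change [Y]. *)
pose Z := step Y.
have dZ i : dac a b (Z i) (rhs Y i) by exact: dac_addc (dac_prim (iY i)).
have Za i : Z i a = y0 i by rewrite /Z /step prim_left addr0.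
have ZY i x : a <= x <= b -> Z i x = Y i x.
  move=> xab; apply/eqP; rewrite -subr_eq0; apply/eqP.
  (* Both [Z] and [Y] are compared with iterate [n.+1]: the first distance is at most
     [2 * K * 2^-1 ^+ n * H x], the second at most [2 * K * 2^-1 ^+ n]. *)
  apply: (@geometric_eq0 _ _ (2 * K * H x + 2 * K)) => n.
    have dF := dac_sub (dZ i) (dYn n i).
  have dG := dac_scale (2 * K * 2^-1 ^+ n) dH.
  have := dac_compare ab dF dG _ xab.
  rewrite (Yna n.+1) Za subrr subr0 Ha mulr0 subr0 => cmp.
  rewrite -(subrK (Yn n.+1 i x) (Z i x)) -addrA (le_trans (ler_normD _ _))// mulrDl lerD//.
    rewrite mulrAC; apply: cmp; apply: aeJ_all => t /Jab' tab.
      rewrite /rhs -sumrB.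
    apply: (le_trans (ler_norm_sum _ _ _)).
    apply: (@le_trans _ _ (\sum_j `|A i j t| * (2 * K * 2^-1 ^+ n))).
      by apply: ler_sum => j _; rewrite -mulrBr normrM ler_wpM2l// YP.
        rewrite -mulr_suml mulrC; apply: ler_wpM2l; last exact: hA.
    by apply: mulr_ge0; [exact: mulr_ge0|rewrite exprn_ge0// invr_ge0].
  rewrite distrC; apply: (le_trans (YP i x xab n.+1)); rewrite exprS.
  apply: ler_wpM2l; first exact: mulr_ge0.
  by apply: ler_piMl; [rewrite exprn_ge0// invr_ge0|rewrite invf_le1 ?ler1n].
exists Z => i; split; last exact: Za.
apply: dac_ext (dZ i) _; apply: aeJ_all => x /Jab' xab.
by apply: eq_bigr => j _; rewrite ZY.
Qed.
End linear_ode.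

(** * Complex-valued functions and L2 *)

Section complex_components.
Local Open Scope complex_scope.
Context (R : realType).
Local Notation C := R[i].
Local Notation Re := complex.Re.
Local Notation Im := complex.Im.
Implicit Types z w : C.

Lemma cReD z w : Re (z + w) = Re z + Re w. Proof. by case: z; case: w. Qed.
Lemma cImD z w : Im (z + w) = Im z + Im w. Proof. by case: z; case: w. Qed.
Lemma cReN z : Re (- z) = - Re z. Proof. by case: z. Qed.
Lemma cImN z : Im (- z) = - Im z. Proof. by case: z. Qed.
Lemma cReM z w : Re (z * w) = Re z * Re w - Im z * Im w.
Proof. by case: z; case: w. Qed.
Lemma cImM z w : Im (z * w) = Re z * Im w + Im z * Re w.
Proof. by case: z; case: w. Qed.
Lemma cReJ z : Re z^* = Re z. Proof. by case: z. Qed.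
Lemma cImJ z : Im z^* = - Im z. Proof. by case: z. Qed.
Lemma cReC (x : R) : Re x%:C = x. Proof. by []. Qed.
Lemma cImC (x : R) : Im x%:C = 0. Proof. by []. Qed.
Lemma cRe0 : Re (0 : C) = 0. Proof. by []. Qed.
Lemma cIm0 : Im (0 : C) = 0. Proof. by []. Qed.
Lemma cRe1 : Re (1 : C) = 1. Proof. by []. Qed.
Lemma cIm1 : Im (1 : C) = 0. Proof. by []. Qed.

Definition cE := (cReD, cImD, cReN, cImN, cReM, cImM, cReJ, cImJ, cReC, cImC,
  cRe0, cIm0, cRe1, cIm1).

Lemma complex_eqP z w : Re z = Re w -> Im z = Im w -> z = w.
Proof. by case: z => ? ?; case: w => ? ? /= -> ->. Qed.

Local Notation norm := (@Normc.normc R).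

Lemma normcE z : norm z = Num.sqrt (Re z ^+ 2 + Im z ^+ 2).
Proof. by case: z. Qed.

Lemma normc_ge0 z : 0 <= norm z. Proof. by rewrite normcE sqrtr_ge0. Qed.

Lemma sqr_normc z : norm z ^+ 2 = Re z ^+ 2 + Im z ^+ 2.
Proof. by rewrite normcE sqr_sqrtr// addr_ge0// sqr_ge0. Qed.

Lemma normc_Re z : `|Re z| <= norm z.
Proof. by rewrite normcE -sqrtr_sqr ler_wsqrtr// lerDl sqr_ge0. Qed.

Lemma normc_Im z : `|Im z| <= norm z.
Proof. by rewrite normcE -sqrtr_sqr ler_wsqrtr// lerDr sqr_ge0. Qed.

Lemma normc_le z : norm z <= `|Re z| + `|Im z|.
Proof.
have s0 : 0 <= `|Re z| + `|Im z| by rewrite addr_ge0.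
rewrite normcE -[leRHS](ger0_norm s0) -sqrtr_sqr ler_wsqrtr//.
rewrite sqrrD !real_normK ?num_real// lerD2r lerDl.
by rewrite mulrn_wge0// mulr_ge0.
Qed.

Lemma normcD z w : norm (z + w) <= norm z + norm w.
Proof. exact: le_normcD. Qed.

Lemma normcN' z : norm (- z) = norm z.
Proof. exact: normcN. Qed.

Lemma normcB z w : norm (z - w) <= norm z + norm w.
Proof. by rewrite -[norm w]normcN'; exact: normcD. Qed.

Lemma normcJ z : norm z^* = norm z.
Proof. by rewrite !normcE !cE sqrrN. Qed.

Lemma normc_eq0 z : norm z = 0 -> z = 0.
Proof. exact: Normc.eq0_normc. Qed.

Lemma normc_sum (I : Type) (r : seq I) (P : pred I) (F : I -> C) :
  norm (\sum_(i <- r | P i) F i) <= \sum_(i <- r | P i) norm (F i).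
Proof.
elim/big_ind2 : _ => //; first by rewrite Normc.normc0.
by move=> x1 x2 y1 y2 h1 h2; rewrite (le_trans (normcD _ _))// lerD.
Qed.
End complex_components.

Section complex_absolute_continuity.
Local Open Scope complex_scope.
Context (R : realType) (a b : R).
Local Notation C := R[i].
Local Notation Re := complex.Re.
Local Notation Im := complex.Im.
Local Notation mu := (@lebesgue_measure R).
Local Notation J := (`]a, b[%classic : set R).
Local Notation norm := (@Normc.normc R).
Local Notation dac := (dac a b).
Local Notation AC := (@Defs.AC R).
Local Notation aeJae := (aeJae a b).
Implicit Types F G f g : R -> C.

(** Bridges the two encodings: degenerate intervals contribute nothing, and the others are
    enumerated by an ordinal. The map [p] stands for the real or imaginary part. *)
Lemma AC_comp F (p : C -> R) : (forall z w, `|p z - p w| <= norm (z - w)) ->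
  AC a b F -> acr a b (fun x => p (F x)).
Proof.
move=> plip aF e e0; have [d d0 H] := aF e e0; exists d => // I u v uv tuv sd.
pose A := [set i | u i < v i]%SET.
have out i : i \notin A -> u i = v i.
  rewrite inE -leNgt => vu; apply/le_anti; rewrite vu andbT.
  by have [] := uv i.
have sumA (G : I -> R) : (forall i, i \notin A -> G i = 0) ->
    \sum_i G i = \sum_(j < #|A|) G (enum_val j).
  move=> G0; rewrite (bigID (mem A))/= [X in _ + X]big1 ?addr0//.
  by rewrite -big_enum_val.
rewrite sumA; last by move=> i /out ->; rewrite subrr normr0.
apply: (@le_lt_trans _ _ (\sum_(j < #|A|) norm (F (v (enum_val j)) - F (u (enum_val j))))).
  by apply: ler_sum => j _; exact: plip.
apply: (H _ (fun j : 'I_#|A| => u (enum_val j)) (fun j => v (enum_val j))).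
- move=> j; have [? ? ?] := uv (enum_val j); split => //.
  by have := enum_valP j; rewrite inE.
- by move=> i j _ _ /tuv => /(_ Logic.I Logic.I); exact: enum_val_inj.
- by rewrite -(sumA (fun i => v i - u i))// => i /out ->; rewrite subrr.
Qed.

Lemma AC_acr F : AC a b F <->
  acr a b (fun x => Re (F x)) /\ acr a b (fun x => Im (F x)).
Proof.
split=> [aF|[aR aI] e e0].
  have lipR (z w : C) : `|Re z - Re w| <= norm (z - w).
    by rewrite -cReN -cReD; exact: normc_Re.
  have lipI (z w : C) : `|Im z - Im w| <= norm (z - w).
    by rewrite -cImN -cImD; exact: normc_Im.
  by split; [exact (@AC_comp F _ lipR aF)|exact (@AC_comp F _ lipI aF)].
have e20 : 0 < e / 2 by rewrite divr_gt0.
have [d d0 H] := aR _ e20; have [d' d'0 H'] := aI _ e20.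
exists (Num.min d d'); first by rewrite lt_min d0 d'0.
move=> n u v uv tuv; rewrite lt_min => /andP[s1 s2].
have uv' i : [/\ a <= u i, u i <= v i & v i <= b].
  by have [? /ltW ? ?] := uv i.
have h := H _ u v uv' tuv s1; have h' := H' _ u v uv' tuv s2.
apply: (@le_lt_trans _ _ (\sum_i (`|Re (F (v i)) - Re (F (u i))| +
  `|Im (F (v i)) - Im (F (u i))|))).
  by apply: ler_sum => i _; rewrite -!cReN -!cImN -cReD -cImD; exact: normc_le.
by rewrite big_split/= [ltRHS]splitr ltrD.
Qed.

Definition cdac F f : Prop :=
  dac (fun x => Re (F x)) (fun x => Re (f x)) /\
  dac (fun x => Im (F x)) (fun x => Im (f x)).

Lemma cdac_AC F f : cdac F f -> AC a b F.
Proof. by move=> [[aR _] [aI _]]; apply/AC_acr. Qed.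

(** [cderive] has a default value where no derivative exists; absolute continuity confines those
    points to a null set. *)
Lemma AC_cdac F : a <= b -> AC a b F -> cdac F (cderive F).
Proof.
move=> ab /AC_acr[aR aI]; have [r [_ dR _]] := acr_derive ab aR.
have [s [_ dI _]] := acr_derive ab aI.
split.
  apply: (dac_ext dR); case: dR => _; apply: aeJ_imp => x _ dx.
  by rewrite /cderive /= derive1E (@derive_val _ _ _ _ _ _ _ dx).
apply: (dac_ext dI); case: dI => _; apply: aeJ_imp => x _ dx.
by rewrite /cderive /= derive1E (@derive_val _ _ _ _ _ _ _ dx).
Qed.

Lemma cdac_cderive F f : cdac F f -> aeJ a b (cderive F) f.
Proof.
move=> [[_ dR] [_ dI]]; apply: aeJ_imp2 dR dI => x _ dR dI.
by apply: complex_eqP; rewrite /cderive /= derive1E derive_val.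
Qed.

Lemma cdac_ext F f g : cdac F f -> aeJ a b f g -> cdac F g.
Proof.
by move=> [dR dI] fg; split; [apply: dac_ext dR _|apply: dac_ext dI _];
  apply: aeJ_imp fg => x _ ->.
Qed.

Lemma cdac_eq F G f : (forall x, a <= x <= b -> F x = G x) -> cdac F f -> cdac G f.
Proof.
by move=> FG [dR dI]; split; [apply: dac_eq dR|apply: dac_eq dI] => x /FG ->.
Qed.

Lemma cdac_add F f G g : cdac F f -> cdac G g ->
  cdac (fun x => F x + G x) (fun x => f x + g x).
Proof.
move=> [F1 F2] [G1 G2]; rewrite /cdac; split.
  by under eq_fun do rewrite cE; under [X in dac _ X]eq_fun do rewrite cE; exact: dac_add.
by under eq_fun do rewrite cE; under [X in dac _ X]eq_fun do rewrite cE; exact: dac_add.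
Qed.

Lemma cdac_opp F f : cdac F f -> cdac (fun x => - F x) (fun x => - f x).
Proof.
have opp (k h : R -> R) : dac k h -> dac (fun x => - k x) (fun x => - h x).
  move=> /(dac_scale (-1)).
  by under eq_fun do rewrite mulN1r; under [X in dac _ X]eq_fun do rewrite mulN1r.
move=> [F1 F2]; rewrite /cdac; split.
  by under eq_fun do rewrite cE; under [X in dac _ X]eq_fun do rewrite cE; exact: opp.
by under eq_fun do rewrite cE; under [X in dac _ X]eq_fun do rewrite cE; exact: opp.
Qed.

Lemma cdac_sub F f G g : cdac F f -> cdac G g ->
  cdac (fun x => F x - G x) (fun x => f x - g x).
Proof. by move=> dF /cdac_opp; exact: cdac_add. Qed.

Lemma cdac_mul F f G g : cdac F f -> cdac G g ->
  cdac (fun x => F x * G x) (fun x => f x * G x + F x * g x).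
Proof.
move=> [F1 F2] [G1 G2]; rewrite /cdac; split.
  under eq_fun do rewrite cE.
  apply: dac_ext (dac_sub (dac_mul F1 G1) (dac_mul F2 G2)) _.
  by apply: aeJ_all => x _; rewrite !cE; ring.
under eq_fun do rewrite cE.
apply: dac_ext (dac_add (dac_mul F1 G2) (dac_mul F2 G1)) _.
by apply: aeJ_all => x _; rewrite !cE; ring.
Qed.

Lemma cdac_cst k : cdac (fun=> k) (fun=> 0).
Proof. by split; exact: dac_cst. Qed.

Lemma cdac_scale k F f : cdac F f -> cdac (fun x => k * F x) (fun x => k * f x).
Proof.
move=> dF; apply: cdac_ext (cdac_mul (cdac_cst k) dF) _.
by apply: aeJ_all => x _; rewrite mul0r add0r.
Qed.

Lemma cdac_conj F f : cdac F f -> cdac (fun x => (F x)^*) (fun x => (f x)^*).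
Proof.
move=> [F1 F2]; rewrite /cdac; split.
  by under eq_fun do rewrite cE; under [X in dac _ X]eq_fun do rewrite cE.
under eq_fun do rewrite cE; under [X in dac _ X]eq_fun do rewrite cE.
apply: dac_eq (fun x _ => mulN1r _) (dac_ext (dac_scale (-1) F2) _).
by apply: aeJ_all => x _; rewrite mulN1r.
Qed.

Lemma cdac_const F f : a <= b -> cdac F f -> aeJ a b f (cst 0) ->
  forall x, a <= x <= b -> F x = F a.
Proof.
move=> ab [F1 F2] f0 x xab; apply: complex_eqP.
  by apply: (dac_const ab F1 _ xab); apply: aeJ_imp f0 => t _ ->.
by apply: (dac_const ab F2 _ xab); apply: aeJ_imp f0 => t _ ->.
Qed.

Lemma AC_ae0 F : a < b -> AC a b F -> aeJ a b F (cst 0) ->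
  forall x, a <= x <= b -> F x = 0.
Proof.
move=> ab /AC_acr[F1 F2] f0 x xab; apply: complex_eqP.
  by apply: (acr_ae0 ab F1 _ xab); apply: aeJ_imp f0 => t _ ->.
by apply: (acr_ae0 ab F2 _ xab); apply: aeJ_imp f0 => t _ ->.
Qed.

Lemma AC_bounded F : AC a b F -> exists2 M : R, 0 <= M &
  forall x, a <= x <= b -> norm (F x) <= M.
Proof.
move=> /AC_acr[/acr_bounded[M M0 MP] /acr_bounded[N N0 NP]].
exists (M + N); first exact: addr_ge0.
by move=> x xab; rewrite (le_trans (normc_le _))// lerD// ?MP ?NP.
Qed.

Lemma cdac_prim (f : R -> C) : intJ a b (fun x => Re (f x)) -> intJ a b (fun x => Im (f x)) ->
  cdac (fun x => prim a b (fun x => Re (f x)) x +i* prim a b (fun x => Im (f x)) x) f.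
Proof. by move=> i1 i2; split; exact: dac_prim. Qed.

Lemma AC_intJ F : AC a b F -> intJ a b (fun x => Re (F x)) /\ intJ a b (fun x => Im (F x)).
Proof. by move=> /AC_acr[? ?]; split; exact: acr_intJ. Qed.

Lemma aeJ_sym (V : Type) (f g : R -> V) : aeJ a b f g -> aeJ a b g f.
Proof. by move=> fg; apply: aeJ_imp fg => x _ ->. Qed.

Lemma aeJ_trans (V : Type) (g f h : R -> V) : aeJ a b f g -> aeJ a b g h -> aeJ a b f h.
Proof. by move=> fg gh; apply: aeJ_imp2 fg gh => x _ -> ->. Qed.
End complex_absolute_continuity.

(** * Monotonicity of the integral beyond measurable functions *)

Section lower_integral.
Local Open Scope complex_scope.
Context d (T : measurableType d) (R : realType) (mu : {measure set T -> \bar R}).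
Import HBNNSimple.

(* The integral of a nonnegative function that is not measurable is its lower
   integral, which is still monotone; elements of [L2] are only almost everywhere
   equal to Borel functions. *)
Lemma ge0_ae_le_lower_integral (f g : T -> \bar R) :
  (forall x, (0 <= f x)%E) -> (forall x, (0 <= g x)%E) ->
  {ae mu, forall x, (f x <= g x)%E} ->
  (\int[mu]_x f x <= \int[mu]_x g x)%E.
Proof.
move=> f0 g0 [N [mN N0 fgN]].
rewrite [leLHS]ge0_integralTE// [leRHS]ge0_integralTE//.
apply: ge_ereal_sup => _ [h hf <-].
have mNC : measurable (~` N) by exact: measurableC.
(* Setting the simple function to 0 on [N] keeps its integral and puts it below [g] everywhere. *)
pose h' := proj_nnsfun h mNC.
have h'E x : h' x = h x * \1_(~` N) x by [].
have -> : sintegral mu h = sintegral mu h'.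
  rewrite -!integralT_nnsfun; apply: ae_eq_integral => //.
  - exact/measurable_EFinP.
  - exact/measurable_EFinP.
  exists N; split => // x /= hx; apply: contrapT => nNx; apply: hx => _.
    by rewrite mindicE mem_set// mulr1.
apply: ereal_sup_ubound; exists h' => // x.
rewrite h'E indicE; have [|] := boolP (x \in ~` N); rewrite ?mulr0 ?mulr1// inE => nNx.
apply: (le_trans (hf x)); apply: contrapT => fg; apply: nNx; exact: fgN.
Qed.
End lower_integral.

(** * The space L2 of a finite interval *)

Section L2_space.
Local Open Scope complex_scope.
Context (R : realType) (a b : R).
Local Notation C := R[i].
Local Notation Re := complex.Re.
Local Notation Im := complex.Im.
Local Notation mu := (@lebesgue_measure R).
Local Notation J := (`]a, b[%classic : set R).
Local Notation norm := (@Normc.normc R).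
Local Notation L2norm := (L2norm a b).
Local Notation L2 := (L2 a b).
Implicit Types f g F G : R -> C.

Lemma L2normE f : L2norm f = 'N[mu]_2%:E[EFin \o ((fun x => norm (f x)) \_ J)]%E.
Proof. by rewrite /L2norm -restrict_EFin. Qed.

Lemma L2norm_ge0 f : (0 <= L2norm f)%E. Proof. exact: Lnorm_ge0. Qed.

Lemma L2norm_ae_le f g : aeJae a b (fun x => norm (f x) <= norm (g x)) ->
  (L2norm f <= L2norm g)%E.
Proof.
move=> fg; rewrite !L2normE unlock; apply: gt0_ler_poweR => //.
- by rewrite in_itv /= leey integral_ge0// => x _; exact: poweR_ge0.
- by rewrite in_itv /= leey integral_ge0// => x _; exact: poweR_ge0.
apply: ge0_ae_le_lower_integral.
- by move=> x; exact: poweR_ge0.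
- by move=> x; exact: poweR_ge0.
move: fg; rewrite /aeJae; apply: filterS; first exact: (ae_filter_ringOfSetsType mu).
move=> x /= h; rewrite !patchE; case: ifPn => [|_]; last exact: lexx.
rewrite inE /= => /h hx; rewrite lee_fin ge0_ler_powR//.
by rewrite !ger0_norm ?normc_ge0.
Qed.

Lemma L2norm_ae_eq f g : aeJ a b f g -> L2norm f = L2norm g.
Proof.
move=> fg; apply/le_anti/andP; split; apply: L2norm_ae_le;
  by apply: aeJ_imp fg => x _ ->.
Qed.

Lemma normc_real (x : R) : 0 <= x -> norm x%:C = x.
Proof. by move=> x0; rewrite normcE !cE expr0n addr0 sqrtr_sqr ger0_norm. Qed.

Lemma L2norm_cst (M : R) : a <= b -> 0 <= M -> L2norm (fun=> M%:C) = (M * Num.sqrt (b - a))%:E.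
Proof.
move=> ab M0; rewrite L2normE unlock.
have -> : (\int[mu]_x (`|(EFin \o ((fun=> norm M%:C) \_ J)) x| `^ 2) = (M ^+ 2 * (b - a))%:E)%E.
  transitivity (\int[mu]_(x in J) (M ^+ 2)%:E)%E.
    rewrite [RHS]integral_mkcond; apply: eq_integral => x _.
      rewrite patchE /comp patchE; case: ifPn => _; last by rewrite /= normr0 powR0.
    by rewrite normc_real// abse_EFin poweR_EFin ger0_norm// -powR_mulrn.
    rewrite integral_cst; last exact: measurable_itv.
      by rewrite (EFinM (M ^+ 2) (b - a)) -(lebesgue_measure_itvoo ab).
rewrite poweR12_sqrt; last by rewrite lee_fin mulr_ge0// ?sqr_ge0// subr_ge0.
by rewrite /= sqrtrM ?sqr_ge0// sqrtr_sqr ger0_norm.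
Qed.

Lemma L2norm_le_cst f (M : R) : a <= b -> 0 <= M ->
  aeJae a b (fun x => norm (f x) <= M) -> (L2norm f <= (M * Num.sqrt (b - a))%:E)%E.
Proof.
move=> ab M0 fM; rewrite -L2norm_cst//; apply: L2norm_ae_le.
by apply: aeJ_imp fM => x _; rewrite normc_real.
Qed.

Lemma measurable_normc f : measurable_fun J (fun x => Re (f x)) ->
  measurable_fun J (fun x => Im (f x)) -> measurable_fun J (fun x => norm (f x)).
Proof.
move=> mR mI; rewrite (_ : (fun x => norm (f x)) =
  Num.sqrt \o (fun x => Re (f x) ^+ 2 + Im (f x) ^+ 2)); last first.
  by apply/funext => x; rewrite normcE.
apply: measurableT_comp.
  by apply: measurable_realfun.continuous_measurable_fun; exact: sqrt_continuous.
by apply: measurable_funD; exact: measurable_funX.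
Qed.

Lemma measurable_restrict_itv (h : R -> R) : measurable_fun J h ->
  measurable_fun [set: R] (h \_ J).
Proof. by move=> mh; apply/(measurable_restrictT _ _).1 => //; exact: measurable_itv. Qed.

Lemma L2_representative f : L2 f -> exists g,
  [/\ measurable_fun J (fun x => Re (g x)), measurable_fun J (fun x => Im (g x)),
      aeJ a b f g & L2norm g = L2norm f].
Proof.
move=> [[r mr fr] [s ms fs] _]; exists (fun x => r x +i* s x).
have fg : aeJ a b f (fun x => r x +i* s x).
  by apply: aeJ_imp2 fr fs => x _ h1 h2; apply: complex_eqP.
by split => //; apply: L2norm_ae_eq; exact: aeJ_sym.
Qed.

Lemma L2_ext f g : aeJ a b f g -> L2 f -> L2 g.
Proof.
move=> fg [[r mr fr] [s ms fs] foo]; split.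
- by exists r => //; apply: aeJ_imp2 fg fr => x _ <-.
- by exists s => //; apply: aeJ_imp2 fg fs => x _ <-.
- by rewrite -(L2norm_ae_eq fg).
Qed.

(** Cauchy-Schwarz against the constant function 1. *)
Lemma integral_normc_le g : a <= b -> measurable_fun J (fun x => Re (g x)) ->
  measurable_fun J (fun x => Im (g x)) ->
  (\int[mu]_(x in J) (norm (g x))%:E <= L2norm g * (Num.sqrt (b - a))%:E)%E.
Proof.
move=> ab mR mI.
have m1 : measurable_fun setT ((fun x => norm (g x)) \_ J).
  by apply: measurable_restrict_itv; exact: measurable_normc.
have m2 : measurable_fun setT ((fun x => 1 : R) \_ J).
  by apply: measurable_restrict_itv; exact: measurable_cst.
have := hoelder mu m1 m2 (ltr0n R 2) (ltr0n R 2) _.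
rewrite -div1r -splitr => /(_ erefl).
rewrite -L2normE Lnorm1.
have -> : ('N[mu]_2%:E[EFin \o ((fun x => 1%R : R) \_ J)] = (Num.sqrt (b - a))%:E)%E.
  by have := L2norm_cst ab ler01; rewrite L2normE normc_real// mul1r.
apply: le_trans; rewrite [leLHS]integral_mkcond le_eqVlt; apply/orP; left; apply/eqP.
apply: eq_integral => x _; rewrite /patch /=; case: ifPn => _.
  by rewrite mulr1 ger0_norm// normc_ge0.
by rewrite mulr0 normr0.
Qed.

Lemma L2norm_fin f : L2 f -> L2norm f \is a fin_num.
Proof. by move=> [_ _ ?]; rewrite ge0_fin_numE// L2norm_ge0. Qed.

Lemma L2_intJ_normc g : a <= b -> measurable_fun J (fun x => Re (g x)) ->
  measurable_fun J (fun x => Im (g x)) -> (L2norm g < +oo)%E ->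
  intJ a b (fun x => norm (g x)).
Proof.
move=> ab mR mI goo; apply/integrableP; split.
  by apply/measurable_EFinP; exact: measurable_normc.
under eq_integral => x _ do rewrite /= ger0_norm ?normc_ge0//.
apply: le_lt_trans (integral_normc_le ab mR mI) _.
by rewrite lte_mul_pinfty// ?L2norm_ge0// ?ge0_fin_numE ?L2norm_ge0// ltry.
Qed.

Lemma intJ_dominated (h k : R -> R) : intJ a b k -> measurable_fun J h ->
  (forall x, a < x < b -> `|h x| <= k x) -> intJ a b h.
Proof.
move=> ik mh hk; apply: (@le_integrable _ _ _ mu J _ (EFin \o h) (EFin \o k)) => //.
  exact/measurable_EFinP.
move=> x; rewrite /= in_itv /= => /hk xk; rewrite lee_fin (le_trans xk)//.
exact: ler_norm.
Qed.

Lemma AC_normc_measurable F : Defs.AC a b F ->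
  measurable_fun J (fun x => Re (F x)) /\ measurable_fun J (fun x => Im (F x)).
Proof. by move=> /AC_acr[? ?]; split; exact: acr_measurable. Qed.

Lemma AC_L2 F : a <= b -> Defs.AC a b F -> L2 F.
Proof.
move=> ab aF; have [mR mI] := AC_normc_measurable aF; split.
- by exists (fun x => Re (F x)) => //; apply: aeJ_all.
- by exists (fun x => Im (F x)) => //; apply: aeJ_all.
have [M M0 FM] := AC_bounded aF.
apply: le_lt_trans (L2norm_le_cst ab M0 _) _; last exact: ltry.
by apply: aeJ_all => x /andP[/ltW ax /ltW xb]; apply: FM; rewrite ax xb.
Qed.

(** Minkowski's inequality is applied to the real functions [norm f'] and [norm g'] of Borel
    representatives, whose sum dominates [norm (f' - g')]. *)
Lemma L2_sub f g : L2 f -> L2 g -> L2 (fun x => f x - g x).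
Proof.
move=> Lf Lg; have [f' [mfR mfI ff' Nf]] := L2_representative Lf.
have [g' [mgR mgI gg' Ng]] := L2_representative Lg.
apply: (@L2_ext (fun x => f' x - g' x)).
  by apply: aeJ_imp2 ff' gg' => x _ -> ->.
split.
- exists (fun x => Re (f' x) - Re (g' x)); first exact: measurable_funB.
  by apply: aeJ_all => x _; rewrite !cE.
- exists (fun x => Im (f' x) - Im (g' x)); first exact: measurable_funB.
  by apply: aeJ_all => x _; rewrite !cE.
have m1 : measurable_fun setT ((fun x => norm (f' x)) \_ J).
  by apply: measurable_restrict_itv; exact: measurable_normc.
have m2 : measurable_fun setT ((fun x => norm (g' x)) \_ J).
  by apply: measurable_restrict_itv; exact: measurable_normc.
have := @minkowski_EFin _ _ _ mu _ _ 2 m1 m2.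
rewrite -!L2normE Nf Ng ler1n => /(_ isT) mink.
have : (L2norm f + L2norm g < +oo)%E by case: Lf; case: Lg => *; rewrite lte_add_pinfty.
apply: le_lt_trans; apply: le_trans mink.
rewrite (_ : EFin \o _ = EFin \o (fun x => norm (norm (f' x) + norm (g' x))%:C) \_ J).
  rewrite -L2normE; apply: L2norm_ae_le; apply: aeJ_all => x _.
  by rewrite normc_real ?addr_ge0 ?normc_ge0//; exact: normcB.
apply/funext => x; rewrite /comp; congr EFin.
rewrite [LHS](_ : _ = ((fun x => norm (f' x)) \_ J) x + ((fun x => norm (g' x)) \_ J) x)//.
rewrite !patchE; case: ifPn => _; last by rewrite addr0.
by rewrite normc_real ?addr_ge0 ?normc_ge0.
Qed.

(** [G] is the integral of [f F] from [a], bounded by [integral_normc_le]; the factor 2 comes from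
    treating real and imaginary parts separately. *)
Lemma L2_primitive f (F : R -> C) (M : R) : a <= b -> L2 f -> Defs.AC a b F ->
  (forall x, a <= x <= b -> norm (F x) <= M) ->
  exists G, [/\ cdac a b G (fun x => f x * F x), G a = 0 &
    forall x, a <= x <= b -> norm (G x) <= 2 * M * Num.sqrt (b - a) * fine (L2norm f)].
Proof.
move=> ab Lf aF FM.
have aab : a <= a <= b by rewrite lexx ab.
have M0 : 0 <= M by rewrite (le_trans (normc_ge0 _) (FM a aab)).
have [g [mR mI fg Ng]] := L2_representative Lf.
have [FR FI] := AC_normc_measurable aF.
have goo : (L2norm g < +oo)%E by rewrite Ng; case: Lf.
have ig := L2_intJ_normc ab mR mI goo.
have igM : intJ a b (fun x => M * norm (g x)).
  by have := intJ_lin M 0 ig ig; apply: intJ_eq => x _; rewrite mul0r addr0.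
have gFM x : a < x < b -> norm (g x * F x) <= M * norm (g x).
  move=> /andP[/ltW ax /ltW xb]; rewrite Normc.normcM mulrC ler_wpM2r ?normc_ge0//.
  by apply: FM; rewrite ax xb.
have iR : intJ a b (fun x => Re (g x * F x)).
  apply: (intJ_dominated igM) => [|x xab].
    rewrite (_ : (fun x => _) = fun x => Re (g x) * Re (F x) - Im (g x) * Im (F x)).
      by apply: measurable_funB; exact: measurable_funM.
    by apply/funext => x; rewrite cE.
  by rewrite (le_trans (normc_Re _))// gFM.
have iI : intJ a b (fun x => Im (g x * F x)).
  apply: (intJ_dominated igM) => [|x xab].
    rewrite (_ : (fun x => _) = fun x => Re (g x) * Im (F x) + Im (g x) * Re (F x)).
      by apply: measurable_funD; exact: measurable_funM.
    by apply/funext => x; rewrite cE.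
  by rewrite (le_trans (normc_Im _))// gFM.
have dG := cdac_prim iR iI.
exists (fun x => prim a b (fun x => Re (g x * F x)) x +i* prim a b (fun x => Im (g x * F x)) x).
have cmp (h : R -> R) : intJ a b h -> (forall x, a < x < b -> `|h x| <= M * norm (g x)) ->
    forall x, a <= x <= b -> `|prim a b h x| <= M * Num.sqrt (b - a) * fine (L2norm f).
  move=> ih hM x xab; have bab : a <= b <= b by rewrite lexx ab.
  have dg := dac_prim ig.
  have := dac_compare ab (dac_prim ih) (dac_scale M dg) (aeJ_all hM) xab.
  rewrite !prim_left mulr0 !subr0 => h1; apply: (le_trans h1).
  rewrite -mulrA; apply: ler_wpM2l => //.
  have nd := dac_nondecreasing ab dg (aeJ_all (fun t _ => normc_ge0 (g t))).
  move: xab => /andP[ax xb]; apply: (le_trans (nd _ _ ax xb (lexx b))).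
  rewrite -[leLHS]subr0 -(prim_left a b (fun x => norm (g x))).
  rewrite prim_left subr0 prim_itv// -Rintegral_itv_bndo_bndc//.
  rewrite /Rintegral -lee_fin fineK; last exact: integrable_fin_num.
  rewrite (le_trans (integral_normc_le ab mR mI))// Ng muleC EFinM fineK//.
  exact: L2norm_fin.
split.
- by apply: cdac_ext dG _; apply: aeJ_imp fg => x _ ->.
- by rewrite !prim_left.
move=> x xab; apply: (le_trans (normc_le _)) => /=.
rewrite -!mulrA mulr_natl mulr2n; apply: lerD; rewrite mulrA; apply: cmp => // t tab.
  by rewrite (le_trans (normc_Re _))// gFM.
by rewrite (le_trans (normc_Im _))// gFM.
Qed.
End L2_space.

(** * The Sturm-Liouville system *)

Section sturm_liouville_system.
Local Open Scope complex_scope.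
Context (R : realType) (a b : R) (g1 g2 g3 : R -> R) (lam : R[i]).
Local Notation C := R[i].
Local Notation Re := complex.Re.
Local Notation Im := complex.Im.
Local Notation norm := (@Normc.normc R).
Local Notation cdac := (cdac a b).
Local Notation aeJ := (aeJ a b).
Local Notation AC := (@Defs.AC R).
Local Notation L2 := (L2 a b).
Local Notation L2norm := (L2norm a b).
Implicit Types f y u w v : R -> C.

(** Stated for arbitrary coefficients, later the integrable representatives of [1/p], [Q/p],
    [Q^2/p], and for a free [u], so that no choice of a representative of the quasi-derivative
    intervenes. *)
Definition isSol y u f : Prop :=
  cdac y (fun x => (g2 x)%:C * y x + (g1 x)%:C * u x) /\
  cdac u (fun x => - (g2 x)%:C * u x - ((g3 x)%:C + lam) * y x - f x).

Lemma isSol_AC y u f : isSol y u f -> AC a b y /\ AC a b u.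
Proof. by move=> [/cdac_AC ? /cdac_AC ?]. Qed.

Lemma isSol_ext y u f f' : aeJ f f' -> isSol y u f -> isSol y u f'.
Proof.
move=> ff' [dy du]; split=> //; apply: cdac_ext du _.
by apply: aeJ_imp ff' => x _ ->.
Qed.

Lemma isSol_eq y u y' u' f : (forall x, a <= x <= b -> y x = y' x) ->
  (forall x, a <= x <= b -> u x = u' x) -> isSol y u f -> isSol y' u' f.
Proof.
move=> yy uu [dy du].
have yyJ x : a < x < b -> y x = y' x by move=> /andP[/ltW ax /ltW xb]; rewrite yy ?ax.
have uuJ x : a < x < b -> u x = u' x by move=> /andP[/ltW ax /ltW xb]; rewrite uu ?ax.
split; [apply: cdac_eq yy (cdac_ext dy _)|apply: cdac_eq uu (cdac_ext du _)];
  by apply: aeJ_all => x xJ; rewrite ?yyJ ?uuJ.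
Qed.

Lemma isSol_lin k y u f w v f' : isSol y u f -> isSol w v f' ->
  isSol (fun x => y x + k * w x) (fun x => u x + k * v x) (fun x => f x + k * f' x).
Proof.
move=> [dy du] [dw dv]; split.
  apply: cdac_ext (cdac_add dy (cdac_scale k dw)) _.
  by apply: aeJ_all => x _; ring.
apply: cdac_ext (cdac_add du (cdac_scale k dv)) _.
by apply: aeJ_all => x _; ring.
Qed.

Lemma isSol0 : isSol (fun=> 0) (fun=> 0) (fun=> 0).
Proof.
split; apply: cdac_ext (cdac_cst a b 0) _; apply: aeJ_all => x _ /=; ring.
Qed.

Lemma isSol_sum (I : finType) (c : I -> C) (y u : I -> R -> C) :
  (forall i, isSol (y i) (u i) (fun=> 0)) ->
  isSol (fun x => \sum_i c i * y i x) (fun x => \sum_i c i * u i x) (fun=> 0).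
Proof.
move=> H; elim: (index_enum I) => [|i s IH].
  by apply: isSol_eq isSol0 => x _; rewrite big_nil.
apply: isSol_eq (isSol_ext _ (isSol_lin (c i) IH (H i))) => [x _|x _|].
- by rewrite big_cons addrC.
- by rewrite big_cons addrC.
- by apply: aeJ_all => x _; rewrite mulr0 addr0.
Qed.

Lemma isSol_exists (y0 u0 : C) : a <= b -> intJ a b g1 -> intJ a b g2 -> intJ a b g3 ->
  exists y u, [/\ isSol y u (fun=> 0), y a = y0 & u a = u0].
Proof.
move=> ab i1 i2 i3.
pose lr := Re lam; pose li := Im lam.
(* The equivalent real system for the real and imaginary parts of [y], then of [u]; [li] couples the
   parts. *)
pose A (i j : 'I_4) (x : R) : R :=
  nth 0 (nth [::] [:: [:: g2 x; 0; g1 x; 0]; [:: 0; g2 x; 0; g1 x];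
    [:: - (g3 x + lr); li; - g2 x; 0]; [:: - li; - (g3 x + lr); 0; - g2 x]] i) j.
pose Y0 (i : 'I_4) := nth 0 [:: Re y0; Im y0; Re u0; Im u0] i.
have in2 : intJ a b (fun x => - g2 x).
  by apply: intJ_eq (intJ_lin (-1) 0 i2 i2) => x _; ring.
have in3 : intJ a b (fun x => - (g3 x + lr)).
  by apply: intJ_eq (intJ_lin (-1) (-1) i3 (intJ_cst a b lr)) => x _; ring.
have iA i j : intJ a b (A i j).
  by case: i => [[|[|[|[|//]]]] ?]; case: j => [[|[|[|[|//]]]] ?];
    rewrite /A //=; exact: intJ_cst.
have [Y HY] := linear_ode_exists Y0 ab iA.
pose i0 : 'I_4 := @Ordinal 4 0 isT; pose i1' : 'I_4 := @Ordinal 4 1 isT.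
pose i2' : 'I_4 := @Ordinal 4 2 isT; pose i3' : 'I_4 := @Ordinal 4 3 isT.
have sum4 (F : 'I_4 -> R) : \sum_j F j = F i0 + F i1' + F i2' + F i3'.
  rewrite !big_ord_recl big_ord0 addr0 !addrA.
  by congr (F _ + F _ + F _ + F _); apply: val_inj.
exists (fun x => Y i0 x +i* Y i1' x), (fun x => Y i2' x +i* Y i3' x); split.
- split; split.
  + apply: dac_ext (HY i0).1 _; apply: aeJ_all => x _; rewrite sum4 !cE /A /=; ring.
  + apply: dac_ext (HY i1').1 _; apply: aeJ_all => x _; rewrite sum4 !cE /A /=; ring.
  + apply: dac_ext (HY i2').1 _; apply: aeJ_all => x _; rewrite sum4 !cE /A /= /lr /li; ring.
  + apply: dac_ext (HY i3').1 _; apply: aeJ_all => x _; rewrite sum4 !cE /A /= /lr /li; ring.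
- by rewrite (HY i0).2 (HY i1').2 /Y0 /=; apply: complex_eqP.
- by rewrite (HY i2').2 (HY i3').2 /Y0 /=; apply: complex_eqP.
Qed.

(** Bilinear, without conjugation, so that it yields both the constancy of the Wronskian and,
    through [isSol_conj], Green's formula. *)
Lemma lagrange y u f w v f' : isSol y u f -> isSol w v f' ->
  cdac (fun x => y x * v x - u x * w x) (fun x => f x * w x - y x * f' x).
Proof.
move=> [dy du] [dw dv]; apply: cdac_ext (cdac_sub (cdac_mul dy dv) (cdac_mul du dw)) _.
by apply: aeJ_all => x _; ring.
Qed.

(** The coefficients are real, so the conjugate solves the equation for the conjugate of [lam]; the
    discrepancy moves into the right-hand side to keep the same [lam]. *)
Lemma isSol_conj y u f : isSol y u f ->
  isSol (fun x => (y x)^*) (fun x => (u x)^*) (fun x => (f x)^* + (lam^* - lam) * (y x)^*).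
Proof.
move=> [dy du]; split.
  apply: cdac_ext (cdac_conj dy) _; apply: aeJ_all => x _.
  by apply: complex_eqP; rewrite !cE; ring.
apply: cdac_ext (cdac_conj du) _; apply: aeJ_all => x _.
by apply: complex_eqP; rewrite !cE; ring.
Qed.

Lemma cdac_unique (F f g : R -> C) : cdac F f -> cdac F g -> aeJ f g.
Proof. by move=> /cdac_cderive/aeJ_sym h /cdac_cderive; exact: aeJ_trans. Qed.

(** Monotonicity squeezes [F] between equal end values. This serves wherever a nonnegative function
    has integral zero. *)
Lemma monotone_const (F h : R -> R) : a < b -> dac a b F h ->
  aeJae a b (fun x => 0 <= h x) -> F a = F b -> aeJae a b (fun x => h x = 0).
Proof.
move=> ab dF h0 Fab; have nd := dac_nondecreasing (ltW ab) dF h0.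
have FE x : a <= x <= b -> F x = F a.
  move=> /andP[ax xb]; apply/le_anti/andP; split; last exact: nd.
  by rewrite Fab; exact: nd.
have [_ d0] := dac_eq (fun x xab => esym (FE x xab)) (dac_cst a b (F a)).
case: dF => _ dF; apply: aeJ_imp2 dF d0 => x _ d1 d2.
exact: is_derive_unique d1 d2.
Qed.

(* By the Lagrange identity for [y] and its conjugate, the boundary condition
   says that the primitive of [2 Im(lam) |y|^2] has the same value at [a] and [b]. *)
Lemma isSol_zero y u : a < b -> Im lam != 0 -> aeJae a b (fun x => g1 x != 0) ->
  isSol y u (fun=> 0) ->
  Im (u a * (y a)^*) = Im (u b * (y b)^*) ->
  forall x, a <= x <= b -> y x = 0 /\ u x = 0.
Proof.
move=> ab l0 g0 sol bc.
have [aY aU] := isSol_AC sol.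
have [_ dI] := lagrange sol (isSol_conj sol).
(* The Lagrange identity gives [2 i Im(lam) |y|^2] as derivative of the bracket; the normalization
   leaves [|y|^2]. *)
pose F x := (2 * Im lam)^-1 * (Im (y x * (u x)^* - u x * (y x)^*)).
have dF : dac a b F (fun x => norm (y x) ^+ 2).
  apply: dac_ext (dac_scale _ dI) _; apply: aeJ_all => x _.
  by rewrite sqr_normc !cE; field.
have y0 : aeJae a b (fun x => norm (y x) ^+ 2 = 0).
  apply: (monotone_const ab dF); first by apply: aeJ_all => x _; exact: sqr_ge0.
  rewrite /F; congr (_ * _); move: bc; rewrite !cE; lra.
have {}y0 x : a <= x <= b -> y x = 0.
  apply: (AC_ae0 ab aY); apply: aeJ_imp y0 => t _ h; apply: normc_eq0.
  by apply/eqP; rewrite -sqrf_eq0; apply/eqP.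
move=> x xab; split; first exact: y0.
(* With [y = 0] the first equation reads [g1 u = 0], and [g1] is nonzero almost everywhere. *)
apply: (AC_ae0 ab aU _ xab).
have dy0 : cdac y (fun=> 0).
  by apply: cdac_eq (cdac_cst a b 0) => t tab; rewrite y0.
have := cdac_unique sol.1 dy0; apply: aeJ_imp2 g0 => t /andP[/ltW ta /ltW tb] gt.
rewrite y0 ?ta// mulr0 add0r => /eqP; rewrite mulf_eq0 => /orP[|/eqP//].
by rewrite eq_complex /= (negbTE gt).
Qed.
End sturm_liouville_system.

(** * Matrix estimates and unitary matrices *)

Section matrix_l1_norm.
Local Open Scope complex_scope.
Context (R : realType).
Local Notation C := R[i].
Local Notation norm := (@Normc.normc R).

(** A submultiplicative norm computed from entries; for 2 x 2 matrices it is within a factor 4 of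
    the operator norm. *)
Definition mxnorm1 m n (A : 'M[C]_(m, n)) : R := \sum_i \sum_j norm (A i j).

Lemma mxnorm1_ge0 m n (A : 'M[C]_(m, n)) : 0 <= mxnorm1 A.
Proof. by apply: sumr_ge0 => i _; apply: sumr_ge0 => j _; exact: normc_ge0. Qed.

Lemma mxnorm1_entry m n (A : 'M[C]_(m, n)) i j : norm (A i j) <= mxnorm1 A.
Proof.
rewrite /mxnorm1 (bigD1 i)//= (bigD1 j)//= -addrA lerDl addr_ge0//.
  by apply: sumr_ge0 => k _; exact: normc_ge0.
by apply: sumr_ge0 => k _; apply: sumr_ge0 => l _; exact: normc_ge0.
Qed.

Lemma mxnorm1D m n (A B : 'M[C]_(m, n)) : mxnorm1 (A + B) <= mxnorm1 A + mxnorm1 B.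
Proof.
rewrite /mxnorm1 -big_split/=; apply: ler_sum => i _.
by rewrite -big_split/=; apply: ler_sum => j _; rewrite mxE; exact: normcD.
Qed.

Lemma mxnorm1N m n (A : 'M[C]_(m, n)) : mxnorm1 (- A) = mxnorm1 A.
Proof.
by apply: eq_bigr => i _; apply: eq_bigr => j _; rewrite mxE normcN'.
Qed.

Lemma mxnorm1M m n k (A : 'M[C]_(m, n)) (B : 'M[C]_(n, k)) :
  mxnorm1 (A *m B) <= mxnorm1 A * mxnorm1 B.
Proof.
rewrite /mxnorm1 mulr_suml; apply: ler_sum => i _.
apply: (@le_trans _ _ (\sum_j \sum_l norm (A i l) * norm (B l j))).
  apply: ler_sum => j _; rewrite mxE; apply: (le_trans (normc_sum _ _ _)).
  by apply: ler_sum => l _; rewrite Normc.normcM.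
rewrite exchange_big/= mulr_suml; apply: ler_sum => l _.
rewrite -mulr_sumr ler_wpM2l ?normc_ge0//.
rewrite (bigD1 l)//= lerDl; apply: sumr_ge0 => l' _; apply: sumr_ge0 => j _.
exact: normc_ge0.
Qed.

Lemma mxnorm1_eq0 m n (A : 'M[C]_(m, n)) : mxnorm1 A = 0 -> A = 0.
Proof.
move=> A0; apply/matrixP => i j; rewrite mxE; apply: normc_eq0.
by apply/le_anti; rewrite normc_ge0 andbT -A0; exact: mxnorm1_entry.
Qed.

Lemma mxnorm1_columns n (A : 'M[C]_n) :
  mxnorm1 A = \sum_j mxnorm1 (A *m delta_mx j (0 : 'I_1)).
Proof.
rewrite /mxnorm1 exchange_big/=; apply: eq_bigr => j _; apply: eq_bigr => i _.
by rewrite big_ord1 -colE mxE.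
Qed.

Lemma mul_col_free_unitmx n (A : 'M[C]_n) :
  (forall c : 'cV[C]_n, A *m c = 0 -> c = 0) -> A \in unitmx.
Proof.
move=> H; rewrite -unitmx_tr -row_free_unit -kermx_eq0; apply/eqP/row_matrixP => i.
rewrite row0; apply: trmx_inj; rewrite trmx0; apply: H.
apply: trmx_inj; rewrite trmx_mul trmxK trmx0.
by rewrite -row_mul mulmx_ker row0.
Qed.

Lemma mul_row_free_unitmx n (A : 'M[C]_n) :
  (forall c : 'rV[C]_n, c *m A = 0 -> c = 0) -> A \in unitmx.
Proof.
move=> H; rewrite -row_free_unit -kermx_eq0; apply/eqP/row_matrixP => i.
by rewrite row0; apply: H; rewrite -row_mul mulmx_ker row0.
Qed.

Lemma unitarymx_isometry n (K : 'M[C]_n) (v : 'cV[C]_n) : K \is unitarymx ->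
  \sum_i norm ((K *m v) i 0) ^+ 2 = \sum_i norm (v i 0) ^+ 2.
Proof.
move=> /unitarymxP/mulmx1C KK.
have E (w : 'cV[C]_n) : (\sum_i norm (w i 0) ^+ 2)%:C = ((map_mx Num.conj w)^T *m w) 0 0.
  rewrite mxE rmorph_sum; apply: eq_bigr => i _; rewrite !mxE.
  by apply: complex_eqP; rewrite sqr_normc !cE; [ring|rewrite /= ; ring].
apply: complexI; rewrite !E map_mxM trmx_mul -mulmxA [X in (_ *m X) 0 0]mulmxA.
have KK' : (map_mx Num.conj K)^T *m K = 1%:M by rewrite map_trmx.
rewrite (_ : (map_mx _ K)^T *m K = 1%:M); last exact: KK'.
by rewrite mul1mx.
Qed.

Lemma unitarymx_entry_le1 n (K : 'M[C]_n) i j : K \is unitarymx -> norm (K i j) <= 1.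
Proof.
move=> uK; have := unitarymx_isometry (delta_mx j 0) uK.
have -> : \sum_i norm ((delta_mx j 0 : 'cV[C]_n) i 0) ^+ 2 = 1.
  rewrite (bigD1 j)//= big1 ?addr0 => [|k kj].
    have -> : (delta_mx j 0 : 'cV[C]_n) j 0 = 1 by rewrite mxE !eqxx.
    by rewrite Normc.normc1 expr1n.
  have -> : (delta_mx j 0 : 'cV[C]_n) k 0 = 0 by rewrite mxE (negbTE kj).
  by rewrite Normc.normc0 expr0n.
rewrite (bigD1 i)//= -colE mxE => h.
have h2 : norm (K i j) ^+ 2 <= 1.
  by rewrite -h lerDl sumr_ge0// => k _; exact: sqr_ge0.
by rewrite -(@ler_pXn2r _ 2) ?nnegrE ?normc_ge0// expr1n.
Qed.

Lemma unitarymx_mxnorm1 (K : 'M[C]_2) : K \is unitarymx -> mxnorm1 K <= 4.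
Proof.
move=> uK; apply: (@le_trans _ _ (\sum_(i < 2) \sum_(j < 2) (1 : R))).
  by apply: ler_sum => i _; apply: ler_sum => j _; exact: unitarymx_entry_le1.
by rewrite !sumr_const !card_ord -mulrnA.
Qed.

Lemma affine_sub m n (A : 'M[C]_(m, n)) (v w w' : 'cV[C]_m) (c c' : 'cV[C]_n) :
  w' = v + A *m c' -> w = v + A *m c -> w' = w + A *m (c' - c).
Proof. by move=> -> ->; rewrite -addrA -mulmxDr subrKC. Qed.

Lemma sum2 (V : nmodType) (F : 'I_2 -> V) : \sum_i F i = F ord0 + F ord_max.
Proof. by rewrite big_ord_recl big_ord1; congr (_ + F _); apply: val_inj. Qed.

Lemma ord2P (P : 'I_2 -> Prop) : P ord0 -> P ord_max -> forall i, P i.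
Proof.
move=> P0 P1 [[|[|//]] h].
  by rewrite (_ : Ordinal h = ord0)//; apply: val_inj.
by rewrite (_ : Ordinal h = ord_max)//; apply: val_inj.
Qed.
End matrix_l1_norm.

(** * Fundamental system, variation of constants and duality *)

Section fundamental_system.
Local Open Scope complex_scope.
Context (R : realType) (a b : R) (g1 g2 g3 : R -> R) (lam : R[i]).
Local Notation C := R[i].
Local Notation Re := complex.Re.
Local Notation Im := complex.Im.
Local Notation norm := (@Normc.normc R).
Local Notation cdac := (cdac a b).
Local Notation aeJ := (aeJ a b).
Local Notation AC := (@Defs.AC R).
Local Notation L2 := (L2 a b).
Local Notation L2norm := (L2norm a b).
Local Notation isSol := (isSol a b g1 g2 g3 lam).
Implicit Types f y u w v : R -> C.
Context (hab : a < b) (hlam : Im lam != 0).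
Context (g1_neq0 : aeJae a b (fun x => g1 x != 0)).
Context (phi ups : 'I_2 -> R -> C).
Context (solphi : forall i, isSol (phi i) (ups i) (fun=> 0)).
Context (phia : forall i, phi i a = (i == ord0)%:R).
Context (upsa : forall i, ups i a = (i == ord_max)%:R).
Let ab : a <= b := ltW hab.
Let aab : a <= a <= b. Proof. by rewrite lexx ab. Qed.
Let bab : a <= b <= b. Proof. by rewrite lexx ab. Qed.

Definition Phi (c : 'cV[C]_2) x : C := \sum_i c i 0 * phi i x.
Definition Ups (c : 'cV[C]_2) x : C := \sum_i c i 0 * ups i x.

Lemma isSol_Phi c : isSol (Phi c) (Ups c) (fun=> 0).
Proof. exact: (isSol_sum (fun i => c i 0) solphi). Qed.

Lemma Phi_left c : Phi c a = c ord0 0.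
Proof. by rewrite /Phi sum2 !phia /= mulr1 mulr0 addr0. Qed.

Lemma Ups_left c : Ups c a = c ord_max 0.
Proof. by rewrite /Ups sum2 !upsa /= mulr1 mulr0 add0r. Qed.

Lemma wronskian x : a <= x <= b ->
  phi ord0 x * ups ord_max x - ups ord0 x * phi ord_max x = 1.
Proof.
move=> xab; have := cdac_const ab (lagrange (solphi ord0) (solphi ord_max)) _ xab.
rewrite !phia !upsa /= mulr1 mulr0 subr0; apply.
by apply: aeJ_all => t _; rewrite mul0r mulr0 subr0.
Qed.

Lemma fundamental_bounded : exists2 M : R, 0 <= M & forall i x, a <= x <= b ->
  norm (phi i x) <= M /\ norm (ups i x) <= M.
Proof.
have bd i : exists M : R, 0 <= M /\ forall x, a <= x <= b ->
    norm (phi i x) <= M /\ norm (ups i x) <= M.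
  have [a1 a2] := isSol_AC (solphi i).
  have [M M0 MP] := AC_bounded a1; have [N N0 NP] := AC_bounded a2.
  exists (M + N); split=> [|x xab]; first exact: addr_ge0.
  by split; [rewrite (le_trans (MP x xab))// lerDl|rewrite (le_trans (NP x xab))// lerDr].
have [M0 [M0p M0P]] := bd ord0; have [M1 [M1p M1P]] := bd ord_max.
exists (M0 + M1); first exact: addr_ge0.
apply: ord2P => x xab.
  by have [h1 h2] := M0P x xab; rewrite (le_trans h1) ?(le_trans h2) ?lerDl.
by have [h1 h2] := M1P x xab; rewrite (le_trans h1) ?(le_trans h2) ?lerDr.
Qed.

(* Variation of constants, with coefficients given by the primitives of [f phi_i]. *)
Definition yf (G : 'I_2 -> R -> C) x : C := G ord_max x * phi ord0 x - G ord0 x * phi ord_max x.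
Definition uf (G : 'I_2 -> R -> C) x : C := G ord_max x * ups ord0 x - G ord0 x * ups ord_max x.

Definition primitives f (G : 'I_2 -> R -> C) : Prop :=
  forall i, cdac (G i) (fun x => f x * phi i x) /\ G i a = 0.

Lemma primitives_unique f G G' : primitives f G -> primitives f G' ->
  forall i x, a <= x <= b -> G i x = G' i x.
Proof.
move=> PG PG' i x xab; have [d1 z1] := PG i; have [d2 z2] := PG' i.
have := cdac_const ab (cdac_sub d1 d2) _ xab; rewrite z1 z2 subrr => h.
apply/eqP; rewrite -subr_eq0; apply/eqP/h.
by apply: aeJ_all => t _; rewrite subrr.
Qed.

Lemma isSol_yf f G : primitives f G -> isSol (yf G) (uf G) f.
Proof.
move=> PG; have [d0 _] := PG ord0; have [d1 _] := PG ord_max.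
have [p0 q0] := solphi ord0; have [p1 q1] := solphi ord_max.
split.
  apply: cdac_ext (cdac_sub (cdac_mul d1 p0) (cdac_mul d0 p1)) _.
  by apply: aeJ_all => x _; rewrite /yf /uf; ring.
apply: cdac_ext (cdac_sub (cdac_mul d1 q0) (cdac_mul d0 q1)) _.
apply: aeJ_all => x /andP[/ltW ax /ltW xb]; rewrite /yf /uf.
have W : phi ord0 x * ups ord_max x - ups ord0 x * phi ord_max x = 1.
  by apply: wronskian; rewrite ax xb.
apply/eqP; rewrite -subr_eq0; apply/eqP.
transitivity (f x * (1 - (phi ord0 x * ups ord_max x - ups ord0 x * phi ord_max x))).
  ring.
by rewrite W subrr mulr0.
Qed.

Lemma primitives_exist : exists2 k : R, 0 <= k & forall f, L2 f -> exists2 G, primitives f G &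
  forall i x, a <= x <= b -> norm (G i x) <= k * fine (L2norm f).
Proof.
have [M M0 MP] := fundamental_bounded.
exists (2 * M * Num.sqrt (b - a)); first by rewrite !mulr_ge0// sqrtr_ge0.
move=> f Lf; have /choice[G GP] : forall i, exists Gi,
    [/\ cdac Gi (fun x => f x * phi i x), Gi a = 0 &
    forall x, a <= x <= b -> norm (Gi x) <= 2 * M * Num.sqrt (b - a) * fine (L2norm f)].
  move=> i; apply: L2_primitive => //; first by have [] := isSol_AC (solphi i).
  by move=> x /(MP i)[].
by exists G => i; have [] := GP i.
Qed.

Lemma Phi_zero c : (forall x, a <= x <= b -> Phi c x = 0 /\ Ups c x = 0) -> c = 0.
Proof.
move=> H; have [p0 q0] := H a aab; move: p0 q0; rewrite Phi_left Ups_left => c0 c1.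
apply/matrixP => i j; rewrite ord1 mxE; move: i; exact: ord2P.
Qed.

(** Linear independence of [phi_0], [phi_1] in L2: if the combination vanishes, so does its
    companion [Ups c], by the first equation and [g1 != 0], and the values at [a] are the
    coefficients. *)
Lemma Phi_ae_zero c : aeJ (Phi c) (cst 0) -> c = 0.
Proof.
move=> c0; have [aP aU] := isSol_AC (isSol_Phi c).
have P0 x : a <= x <= b -> Phi c x = 0 by exact: AC_ae0.
apply: Phi_zero => x xab; split; first exact: P0.
apply: (AC_ae0 hab aU _ xab).
have dy0 : cdac (Phi c) (fun=> 0).
  by apply: cdac_eq (cdac_cst a b 0) => t tab; rewrite P0.
have := cdac_unique (isSol_Phi c).1 dy0; apply: aeJ_imp2 g1_neq0 => t /andP[/ltW ta /ltW tb] gt.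
rewrite P0 ?ta// mulr0 add0r => /eqP; rewrite mulf_eq0 => /orP[|/eqP//].
by rewrite eq_complex /= (negbTE gt).
Qed.

(* The dual functions are combinations of the conjugates of [phi_i]; the
   coefficients are the inverse of the Gram matrix. *)
Lemma dual_functions : exists g : 'I_2 -> R -> C, (forall j, AC a b (g j)) /\
  exists P : 'I_2 -> 'I_2 -> R -> C, forall i j,
    [/\ cdac (P i j) (fun x => phi i x * g j x), P i j a = 0 & P i j b = (i == j)%:R].
Proof.
have aphi i : AC a b (phi i) by have [] := isSol_AC (solphi i).
have aphic i : AC a b (fun x => (phi i x)^*).
  exact: cdac_AC (cdac_conj (solphi i).1).
have prodAC i k : AC a b (fun x => phi i x * (phi k x)^*).
  exact: cdac_AC (cdac_mul (solphi i).1 (cdac_conj (solphi k).1)).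
have ex i k : exists P, cdac P (fun x => phi i x * (phi k x)^*) /\ P a = 0.
  have [iR iI] := AC_intJ (prodAC i k).
    by have d := cdac_prim iR iI; eexists; split; [exact: d|rewrite /= !prim_left].
have [P PP] : exists P : 'I_2 -> 'I_2 -> R -> C, forall i k,
    cdac (P i k) (fun x => phi i x * (phi k x)^*) /\ P i k a = 0.
    have H i : exists Pi : 'I_2 -> R -> C, forall k,
      cdac (Pi k) (fun x => phi i x * (phi k x)^*) /\ Pi k a = 0.
    by have /choice[Q QP] := ex i; exists Q.
  by have /choice[Q QP] := H; exists Q.
pose Gm : 'M[C]_2 := \matrix_(i, k) P i k b.
have uG : Gm \in unitmx.
  apply: mul_row_free_unitmx => c cG.
  apply: trmx_inj; rewrite trmx0; apply: Phi_ae_zero.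
  (* [Gm] is the Gram matrix, and [S b], its quadratic form at [c], is the integral of
     [|Phi c^T|^2]. It vanishes when [c *m Gm = 0], which forces [Phi c^T = 0]. *)
  pose S x := \sum_i \sum_k c 0 i * (c 0 k)^* * P i k x.
  have dS : cdac S (fun x => Phi c^T x * (Phi c^T x)^*).
    have d00 := cdac_scale (c 0 ord0 * (c 0 ord0)^*) (PP ord0 ord0).1.
    have d01 := cdac_scale (c 0 ord0 * (c 0 ord_max)^*) (PP ord0 ord_max).1.
    have d10 := cdac_scale (c 0 ord_max * (c 0 ord0)^*) (PP ord_max ord0).1.
    have d11 := cdac_scale (c 0 ord_max * (c 0 ord_max)^*) (PP ord_max ord_max).1.
    have := cdac_add (cdac_add d00 d01) (cdac_add d10 d11).
    move=> D; apply: cdac_eq (cdac_ext D _); first by move=> x _; rewrite /S !sum2.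
      apply: aeJ_all => x _; rewrite /Phi !sum2 !mxE.
        move: (c 0 ord0) (c 0 ord_max) (phi ord0 x) (phi ord_max x) => c0 c1 z0 z1.
    by apply: complex_eqP; rewrite !cE; ring.
  have Sa : S a = 0.
    by rewrite /S big1// => i _; rewrite big1// => k _; rewrite (PP i k).2 mulr0.
  have Sb : S b = 0.
    rewrite /S exchange_big/= big1// => k _.
    transitivity ((c 0 k)^* * (c *m Gm) 0 k); last by rewrite cG mxE mulr0.
    by rewrite mxE mulr_sumr; apply: eq_bigr => i _; rewrite mxE; ring.
  case: dS => dR _.
  have := monotone_const hab dR; rewrite Sa Sb => /(_ _ erefl) H.
  have {}H : aeJae a b (fun x => Re (Phi c^T x * (Phi c^T x)^*) = 0).
    apply: H; apply: aeJ_all => x _; rewrite !cE mulrN opprK.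
    by rewrite addr_ge0// -expr2 sqr_ge0.
  apply: aeJ_imp H => x _ h; apply: normc_eq0; apply/eqP; rewrite -sqrf_eq0 sqr_normc.
  by apply/eqP; rewrite -h !cE; ring.
pose X := invmx Gm.
have GX : Gm *m X = 1%:M by exact: mulmxV.
exists (fun j x => \sum_k X k j * (phi k x)^*); split.
  move=> j; have := cdac_add (cdac_scale (X ord0 j) (cdac_conj (solphi ord0).1))
    (cdac_scale (X ord_max j) (cdac_conj (solphi ord_max).1)).
  by move=> /(cdac_eq (G := fun x => \sum_k X k j * (phi k x)^*)) H; apply: cdac_AC (H _) => x _;
    rewrite sum2.
exists (fun i j x => \sum_k X k j * P i k x) => i j; split.
- have D := cdac_add (cdac_scale (X ord0 j) (PP i ord0).1)
    (cdac_scale (X ord_max j) (PP i ord_max).1).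
  apply: cdac_eq (cdac_ext D _); first by move=> x _; rewrite sum2.
  by apply: aeJ_all => x _; rewrite sum2; ring.
- by rewrite big1// => k _; rewrite (PP i k).2 mulr0.
- have := congr1 (fun M : 'M[C]_2 => M i j) GX; rewrite !mxE => <-.
  by apply: eq_bigr => k _; rewrite mxE mulrC.
Qed.

(** The coefficient [c_j] is the integral of [z g_j] for the bounded dual function [g_j]. *)
Lemma coefficient_bound : exists2 k : R, 0 <= k & forall (c : 'cV[C]_2) z, L2 z ->
  aeJ z (Phi c) -> mxnorm1 c <= k * fine (L2norm z).
Proof.
have [g [ag [P PP]]] := dual_functions.
have bg j : exists M : R, 0 <= M /\ forall x, a <= x <= b -> norm (g j x) <= M.
  by have [M M0 MP] := AC_bounded (ag j); exists M.
have /choice[M MP] := bg.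
exists (\sum_j 2 * M j * Num.sqrt (b - a)).
  by apply: sumr_ge0 => j _; rewrite !mulr_ge0 ?sqrtr_ge0//; have [] := MP j.
move=> c z Lz zc; rewrite /mxnorm1 mulr_suml; apply: ler_sum => j _; rewrite big_ord1.
have [G [dG Ga GB]] := L2_primitive ab Lz (ag j) (MP j).2.
suff -> : c j 0 = G b by exact: GB.
have D := cdac_add (cdac_scale (c ord0 0) (let: And3 d _ _ := PP ord0 j in d))
    (cdac_scale (c ord_max 0) (let: And3 d _ _ := PP ord_max j in d)).
have := cdac_const ab (cdac_sub dG D) _ bab.
have [_ e0 e0'] := PP ord0 j; have [_ e1 e1'] := PP ord_max j.
rewrite Ga e0 e1 e0' e1' !mulr0 addr0 subr0 => H.
have {}H : G b - (c ord0 0 * (ord0 == j)%:R + c ord_max 0 * (ord_max == j)%:R) = 0.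
  apply: H; apply: aeJ_imp zc => x _ ->; rewrite /Phi sum2; ring.
apply/eqP; rewrite eq_sym -subr_eq0; apply/eqP; rewrite -[RHS]H; congr (_ - _).
by move: j {G dG Ga GB D e0 e0' e1 e1' H}; apply: ord2P; rewrite /= ?mulr1 ?mulr0 ?addr0 ?add0r.
Qed.

(** Take [f] to be the combination of the dual functions with coefficients [w]. *)
Lemma primitives_onto (w : 'I_2 -> C) : exists2 f, L2 f &
  forall G, primitives f G -> forall i, G i b = w i.
Proof.
have [g [ag [P PP]]] := dual_functions.
have LG : AC a b (fun x => w ord0 * g ord0 x + w ord_max * g ord_max x).
  have d j := AC_cdac ab (ag j).
  exact: cdac_AC (cdac_add (cdac_scale _ (d ord0)) (cdac_scale _ (d ord_max))).
exists (fun x => w ord0 * g ord0 x + w ord_max * g ord_max x); first exact: AC_L2.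
move=> G PG i; pose Q i x := w ord0 * P i ord0 x + w ord_max * P i ord_max x.
have PQ : primitives (fun x => w ord0 * g ord0 x + w ord_max * g ord_max x) Q.
  move=> k; have [d0 e0 _] := PP k ord0; have [d1 e1 _] := PP k ord_max; split.
    apply: cdac_ext (cdac_add (cdac_scale (w ord0) d0) (cdac_scale (w ord_max) d1)) _.
    by apply: aeJ_all => x _; ring.
  by rewrite /Q e0 e1 !mulr0 addr0.
rewrite (primitives_unique PG PQ i bab) /Q.
have [_ _ ->] := PP i ord0; have [_ _ ->] := PP i ord_max.
by move: i; apply: ord2P; rewrite /= ?mulr1 ?mulr0 ?addr0 ?add0r.
Qed.

(* [Pv] and [Nv] are [Gamma1 + i Gamma2] and [Gamma1 - i Gamma2], with [u] in the
   place of the quasi-derivative [D1 y]. *)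
Definition G1v u : 'cV[C]_2 := \col_(i < 2) [:: u a; - u b]`_i.
Definition G2v y : 'cV[C]_2 := \col_(i < 2) [:: y a; y b]`_i.
Definition bc (K : 'M[C]_2) y u : Prop :=
  (K - 1%:M) *m G1v u + Num.imaginary *: ((K + 1%:M) *m G2v y) = 0.
Definition Pv y u : 'cV[C]_2 :=
  \col_(i < 2) [:: u a + Num.imaginary * y a; - u b + Num.imaginary * y b]`_i.
Definition Nv y u : 'cV[C]_2 :=
  \col_(i < 2) [:: u a - Num.imaginary * y a; - u b - Num.imaginary * y b]`_i.

Lemma colP2 (v w : 'cV[C]_2) : v ord0 0 = w ord0 0 -> v ord_max 0 = w ord_max 0 -> v = w.
Proof.
by move=> h0 h1; apply/matrixP => i j; rewrite ord1; move: i; exact: ord2P.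
Qed.

Lemma bcE K y u : bc K y u <-> K *m Pv y u = Nv y u.
Proof.
rewrite /bc; have -> : (K - 1%:M) *m G1v u + Num.imaginary *: ((K + 1%:M) *m G2v y) =
    K *m Pv y u - Nv y u.
    have -> : Pv y u = G1v u + Num.imaginary *: G2v y by apply: colP2; rewrite !mxE.
  have -> : Nv y u = G1v u - Num.imaginary *: G2v y by apply: colP2; rewrite !mxE.
  rewrite mulmxBl mulmxDl mulmxDr !mul1mx scalerDr -scalemxAr opprB.
  by rewrite addrACA; congr (_ + _); rewrite addrC.
by split=> [/eqP|->]; rewrite ?subrr// subr_eq0 => /eqP.
Qed.

Lemma Pv0 y u : Pv y u ord0 0 = u a + Num.imaginary * y a.
Proof. by rewrite mxE. Qed.
Lemma Pv1 y u : Pv y u ord_max 0 = - u b + Num.imaginary * y b.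
Proof. by rewrite !mxE. Qed.
Lemma Nv0 y u : Nv y u ord0 0 = u a - Num.imaginary * y a.
Proof. by rewrite !mxE. Qed.
Lemma Nv1 y u : Nv y u ord_max 0 = - u b - Num.imaginary * y b.
Proof. by rewrite !mxE. Qed.

Lemma Pv_lin (k : C) y u y' u' : Pv (fun x => y x + k * y' x) (fun x => u x + k * u' x) =
  Pv y u + k *: Pv y' u'.
Proof.
by apply: colP2; rewrite ?Pv0 ?Pv1 [RHS]mxE [X in _ = _ + X]mxE ?Pv0 ?Pv1; ring.
Qed.

Lemma Nv_lin (k : C) y u y' u' : Nv (fun x => y x + k * y' x) (fun x => u x + k * u' x) =
  Nv y u + k *: Nv y' u'.
Proof.
by apply: colP2; rewrite ?Nv0 ?Nv1 [RHS]mxE [X in _ = _ + X]mxE ?Nv0 ?Nv1; ring.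
Qed.

(** [PA] and [NA] are the matrices A and B of the overview. *)
Definition PA : 'M[C]_2 := \matrix_(i, j) Pv (phi j) (ups j) i 0.
Definition NA : 'M[C]_2 := \matrix_(i, j) Nv (phi j) (ups j) i 0.

Lemma Pv_Phi c : Pv (Phi c) (Ups c) = PA *m c.
Proof.
have PA0 j : PA ord0 j = ups j a + Num.imaginary * phi j a by rewrite mxE Pv0.
have PA1 j : PA ord_max j = - ups j b + Num.imaginary * phi j b by rewrite mxE Pv1.
apply: colP2; rewrite ?Pv0 ?Pv1 [RHS]mxE sum2 ?PA0 ?PA1 /Phi /Ups !sum2; ring.
Qed.

Lemma Nv_Phi c : Nv (Phi c) (Ups c) = NA *m c.
Proof.
have NA0 j : NA ord0 j = ups j a - Num.imaginary * phi j a by rewrite mxE Nv0.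
have NA1 j : NA ord_max j = - ups j b - Num.imaginary * phi j b by rewrite mxE Nv1.
apply: colP2; rewrite ?Nv0 ?Nv1 [RHS]mxE sum2 ?NA0 ?NA1 /Phi /Ups !sum2; ring.
Qed.

Lemma Pv_eq y u y' u' : (forall x, a <= x <= b -> y x = y' x) ->
  (forall x, a <= x <= b -> u x = u' x) -> Pv y u = Pv y' u'.
Proof. by move=> hy hu; apply: colP2; rewrite ?(Pv0, Pv1) ?hy ?hu. Qed.

(** [Pv] and [Nv] have equal norms as [K] is an isometry, and [|u + i y|^2 - |u - i y|^2] is four
    times the imaginary part of [u conj(y)]. The sign of [u] in the entry at [b] puts the two ends
    on opposite sides. *)
Lemma bc_green (K : 'M[C]_2) y u : K \is unitarymx -> bc K y u ->
  Im (u a * (y a)^*) = Im (u b * (y b)^*).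
Proof.
move=> uK /bcE KP; have := unitarymx_isometry (Pv y u) uK; rewrite KP.
rewrite !sum2 Pv0 Pv1 Nv0 Nv1 !sqr_normc.
rewrite (_ : Num.imaginary = 0 +i* 1 :> C)//.
have iz (z : C) : (0 +i* 1) * z = - Im z +i* Re z.
  by apply: complex_eqP; rewrite !cE /= ?mul0r ?mul1r ?sub0r ?add0r.
have iI (z w : C) : Re (w + (0 +i* 1) * z) = Re w - Im z /\ Im (w + (0 +i* 1) * z) = Im w + Re z.
  by rewrite iz !cE.
have iB (z w : C) : Re (w - (0 +i* 1) * z) = Re w + Im z /\ Im (w - (0 +i* 1) * z) = Im w - Re z.
  by rewrite iz !cE /= opprK.
have [-> ->] := iI (y a) (u a); have [-> ->] := iI (y b) (- u b).
have [-> ->] := iB (y a) (u a); have [-> ->] := iB (y b) (- u b).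
rewrite !cE => H; lra.
Qed.

(** * The boundary value problem and its dependence on the boundary matrix *)

Definition solves K f y u : Prop := isSol y u f /\ bc K y u.

Lemma solves_unique K f y u y' u' : K \is unitarymx ->
  solves K f y u -> solves K f y' u' ->
  forall x, a <= x <= b -> y x = y' x /\ u x = u' x.
Proof.
move=> uK [s1 /bcE b1] [s2 /bcE b2] x xab.
have s := isSol_lin (-1) s1 s2.
have {}s : isSol (fun x => y x + -1 * y' x) (fun x => u x + -1 * u' x) (fun=> 0).
  by apply: isSol_ext s; apply: aeJ_all => t _; rewrite mulN1r subrr.
have [|h1 h2] := isSol_zero hab hlam g1_neq0 s _ xab.
  apply: (@bc_green K (fun x => y x + -1 * y' x) (fun x => u x + -1 * u' x)) => //.
  by apply/bcE; rewrite Pv_lin Nv_lin -b1 -b2 mulmxDr -scalemxAr.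
by split; apply/eqP; rewrite -subr_eq0 -mulN1r; apply/eqP.
Qed.

(** A kernel vector [c] would make [Phi c] a solution of the homogeneous boundary problem, which
    vanishes by [isSol_zero]. *)
Lemma unit_bc_matrix K : K \is unitarymx -> K *m PA - NA \in unitmx.
Proof.
move=> uK; apply: mul_col_free_unitmx => c c0; apply: Phi_zero.
apply: (isSol_zero hab hlam g1_neq0 (isSol_Phi c)).
apply: (bc_green uK); apply/bcE; rewrite Pv_Phi Nv_Phi.
by apply/eqP; rewrite -subr_eq0 mulmxA -mulmxBl c0.
Qed.

(* Locked, as unification otherwise unfolds the inverse matrix. *)
Definition coef K (G : 'I_2 -> R -> C) : 'cV[C]_2 :=
    locked (invmx (K *m PA - NA) *m (Nv (yf G) (uf G) - K *m Pv (yf G) (uf G))).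

Lemma coefE K G : K \is unitarymx ->
  (K *m PA - NA) *m coef K G = Nv (yf G) (uf G) - K *m Pv (yf G) (uf G).
Proof. by move=> uK; rewrite /coef -lock mulKVmx//; exact: unit_bc_matrix. Qed.

(** The factor [1] keeps the shape of [isSol_lin] and [Pv_lin]. *)
Definition ysol K G x : C := yf G x + 1 * Phi (coef K G) x.
Definition usol K G x : C := uf G x + 1 * Ups (coef K G) x.

Lemma Pv_ysol K G : Pv (ysol K G) (usol K G) = Pv (yf G) (uf G) + PA *m coef K G.
Proof. by rewrite Pv_lin Pv_Phi scale1r. Qed.

Lemma Nv_ysol K G : Nv (ysol K G) (usol K G) = Nv (yf G) (uf G) + NA *m coef K G.
Proof. by rewrite Nv_lin Nv_Phi scale1r. Qed.

Lemma ysol_sub K K' G x : ysol K' G x - ysol K G x = Phi (coef K' G - coef K G) x.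
Proof.
rewrite /ysol /Phi; move: (coef K' G) (coef K G) (yf G x) => c c' z.
have cB i : (c - c') i 0 = c i 0 - c' i 0 by rewrite !mxE.
by rewrite !sum2 !cB; ring.
Qed.

Lemma Pv_ysol_sub K K' G : Pv (ysol K' G) (usol K' G) =
  Pv (ysol K G) (usol K G) + PA *m (coef K' G - coef K G).
Proof. exact: (affine_sub (Pv_ysol K' G) (Pv_ysol K G)). Qed.

Lemma Nv_ysol_sub K K' G : Nv (ysol K' G) (usol K' G) =
  Nv (ysol K G) (usol K G) + NA *m (coef K' G - coef K G).
Proof. exact: (affine_sub (Nv_ysol K' G) (Nv_ysol K G)). Qed.

(** Difference of the two linear systems, arranged so that only the inverse for the fixed [K]
    occurs; the price is [coef K'] on the right. *)
Lemma coef_sub K K' G : K \is unitarymx -> K' \is unitarymx ->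
  coef K' G - coef K G = - (invmx (K *m PA - NA) *m
    ((K' - K) *m (Pv (yf G) (uf G) + PA *m coef K' G))).
Proof.
move=> uK uK'; have := coefE G uK; have := coefE G uK'.
have U := unit_bc_matrix uK.
move: (coef K' G) (coef K G) (Pv (yf G) (uf G)) (Nv (yf G) (uf G)) => c' c P N E' E.
apply: (can_inj (mulKmx U)); rewrite mulmxN mulKVmx// mulmxBr E.
move: E'; rewrite !mulmxBl !mulmxDr -!mulmxA.
move: (K *m P) (K' *m P) (K *m (PA *m c')) (K' *m (PA *m c')) (NA *m c').
move=> X X' Y Y' Z E'; have {E'}-> : N = Y' - Z + X' by rewrite E' subrK.
by apply/matrixP => i j; rewrite !mxE; ring.
Qed.

Lemma solves_explicit K f G : K \is unitarymx -> primitives f G ->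
  solves K f (ysol K G) (usol K G).
Proof.
move=> uK PG; split.
  apply: isSol_ext (isSol_lin 1 (isSol_yf PG) (isSol_Phi (coef K G))).
  by apply: aeJ_all => x _; rewrite mulr0 addr0.
apply/bcE; rewrite Pv_ysol Nv_ysol.
have := coefE G uK; rewrite mulmxBl -mulmxA => E.
by rewrite mulmxDr -[X in _ + X](subrK (NA *m coef K G)) E addrA [K *m _ + _]addrC subrK.
Qed.

Lemma normc_i : norm (Num.imaginary : C) = 1.
Proof.
rewrite normcE.
have -> : Re (Num.imaginary : C) = 0 by [].
have -> : Im (Num.imaginary : C) = 1 by [].
by rewrite expr0n add0r expr1n sqrtr1.
Qed.

Lemma mxnorm1_Pv y u (m : R) : (forall x, a <= x <= b -> norm (y x) <= m /\ norm (u x) <= m) ->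
  mxnorm1 (Pv y u) <= 4 * m /\ mxnorm1 (Nv y u) <= 4 * m.
Proof.
move=> H; have [ya ua] := H a aab; have [yb ub] := H b bab.
have iy z : norm (Num.imaginary * z) = norm z by rewrite Normc.normcM normc_i mul1r.
rewrite /mxnorm1 !sum2 !big_ord1 Pv0 Pv1 Nv0 Nv1.
have := normcD (u a) (Num.imaginary * y a); have := normcD (- u b) (Num.imaginary * y b).
have := normcB (u a) (Num.imaginary * y a); have := normcB (- u b) (Num.imaginary * y b).
by rewrite !normcN' !iy => *; split; lra.
Qed.

Lemma norm_Phi : exists2 M : R, 0 <= M & forall c x, a <= x <= b ->
  norm (Phi c x) <= M * mxnorm1 c.
Proof.
have [M M0 MP] := fundamental_bounded; exists M => // c x xab.
rewrite /Phi /mxnorm1 mulr_sumr (le_trans (normc_sum _ _ _))//.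
apply: ler_sum => i _; rewrite big_ord1 Normc.normcM mulrC ler_wpM2r ?normc_ge0//.
by have [] := MP i x xab.
Qed.

Lemma data_bound : exists2 k : R, 0 <= k & forall f, L2 f -> exists G,
  [/\ primitives f G,
      forall x, a <= x <= b -> norm (yf G x) <= k * fine (L2norm f),
      mxnorm1 (Pv (yf G) (uf G)) <= k * fine (L2norm f) &
      mxnorm1 (Nv (yf G) (uf G)) <= k * fine (L2norm f)].
Proof.
have [M M0 MP] := fundamental_bounded; have [k k0 kP] := primitives_exist.
(* Up to the norm of [f], [k * M] bounds one product of a primitive and a fundamental function; [yf]
   and [uf] have two of them, and a boundary vector involves four values. *)
exists (4 * (2 * (k * M))); first by rewrite !mulr_ge0.
move=> f Lf; have [G PG GB] := kP f Lf.
have n0 : 0 <= fine (L2norm f) by rewrite fine_ge0// L2norm_ge0.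
have H x : a <= x <= b -> norm (yf G x) <= 2 * (k * M) * fine (L2norm f) /\
    norm (uf G x) <= 2 * (k * M) * fine (L2norm f).
  move=> xab; have [p0 q0] := MP ord0 x xab; have [p1 q1] := MP ord_max x xab.
  have h0 := GB ord0 x xab; have h1 := GB ord_max x xab.
  have K0 : 0 <= k * fine (L2norm f) by rewrite mulr_ge0.
  have mm (g z : C) : norm g <= k * fine (L2norm f) -> norm z <= M ->
      norm (g * z) <= k * M * fine (L2norm f).
    by move=> hg hz; rewrite Normc.normcM mulrAC ler_pM ?normc_ge0.
  split; apply: (le_trans (normcB _ _)); rewrite -!mulrA mulr_natl mulr2n !mulrA;
    by apply: lerD; apply: mm.
exists G; have [hP hN] := mxnorm1_Pv H; split => //.
- move=> x xab; have [h _] := H x xab; apply: (le_trans h).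
  rewrite -[leRHS]mulrA ler_peMl//; first by rewrite !mulr_ge0.
  by rewrite ler1n.
- by rewrite -mulrA.
- by rewrite -mulrA.
Qed.

Lemma coef_bound K : K \is unitarymx -> exists2 q : R, 0 <= q & forall G m,
  mxnorm1 (Pv (yf G) (uf G)) <= m -> mxnorm1 (Nv (yf G) (uf G)) <= m ->
  mxnorm1 (coef K G) <= q * m.
Proof.
move=> uK; exists (mxnorm1 (invmx (K *m PA - NA)) * (1 + mxnorm1 K)).
  by rewrite mulr_ge0 ?addr_ge0// mxnorm1_ge0.
move=> G m hP hN; rewrite /coef -lock; apply: (le_trans (mxnorm1M _ _)).
rewrite -mulrA ler_wpM2l ?mxnorm1_ge0// (le_trans (mxnorm1D _ _))// mulrDl mul1r.
by rewrite lerD// mxnorm1N (le_trans (mxnorm1M _ _))// ler_wpM2l// mxnorm1_ge0.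
Qed.

Lemma solves_exists K : K \is unitarymx -> exists2 k : R, 0 <= k & forall f, L2 f ->
  exists y u, solves K f y u /\ forall x, a <= x <= b -> norm (y x) <= k * fine (L2norm f).
Proof.
move=> uK; have [k k0 kP] := data_bound; have [q q0 qP] := coef_bound uK.
have [M M0 MP] := norm_Phi.
exists (k + M * (q * k)); first by rewrite addr_ge0// !mulr_ge0.
move=> f Lf; have [G [PG yB hP hN]] := kP f Lf.
exists (ysol K G), (usol K G); split; first exact: solves_explicit.
move=> x xab; rewrite /ysol mul1r mulrDl (le_trans (normcD _ _))// lerD// ?yB//.
rewrite (le_trans (MP _ _ xab))// -!mulrA ler_wpM2l//.
exact: qP.
Qed.

(** [coef_sub] bounds the change [D] of the coefficients by an expression containing [D] itself; for
    [K'] near [K] that term is absorbed in the left-hand side, which gives a bound uniform in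
    [f]. *)
Lemma solves_continuous K (e : R) : K \is unitarymx -> 0 < e -> exists2 d : R, 0 < d &
  forall K', K' \is unitarymx -> mxnorm1 (K' - K) < d -> forall f, L2 f ->
  exists y u y' u', [/\ solves K f y u, solves K' f y' u' &
    forall x, a <= x <= b -> norm (y' x - y x) <= e * fine (L2norm f)].
Proof.
have half_le (s t : R) : 0 <= s -> 2 * t + s < 1 -> t <= 2^-1 by lra.
have absorb (t r s : R) : s <= 2^-1 * t -> t <= r + s -> t <= 2 * r by lra.
have drop_lt (s t : R) : 0 <= s -> t + s < e -> t <= e by lra.
move=> uK e0; have [k k0 kP] := data_bound; have [q q0 qP] := coef_bound uK.
have [M M0 MP] := norm_Phi.
pose m := mxnorm1 (invmx (K *m PA - NA)); pose al := mxnorm1 PA.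
have m0 : 0 <= m by exact: mxnorm1_ge0.
have al0 : 0 <= al by exact: mxnorm1_ge0.
pose B := 2 * M * m * (k + al * (q * k)).
have B0 : 0 <= B by rewrite !mulr_ge0// addr_ge0// !mulr_ge0.
(* [d1] brings the factor of [D] on the right below one half; [d2] is for the final estimate
   [B * mxnorm1 (K' - K) <= e]. *)
pose d1 := (2 * m * al + 1)^-1; pose d2 := e / (B + 1).
have d10 : 0 < d1 by rewrite invr_gt0 ltr_wpDl// !mulr_ge0.
have d20 : 0 < d2 by rewrite divr_gt0// ltr_wpDl.
exists (Num.min d1 d2); first by rewrite lt_min d10.
move=> K' uK' Kd f Lf; have [G [PG yB hP hN]] := kP f Lf.
have cB := qP G _ hP hN.
exists (ysol K G), (usol K G), (ysol K' G), (usol K' G).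
split; [exact: solves_explicit|exact: solves_explicit|].
pose D := coef K' G - coef K G.
have DE := coef_sub G uK uK' : D = _.
set N := fine (L2norm f).
have N0 : 0 <= N by rewrite fine_ge0// L2norm_ge0.
set dd := mxnorm1 (K' - K).
have dd0 : 0 <= dd by exact: mxnorm1_ge0.
have c'B : mxnorm1 (coef K' G) <= q * (k * N) + mxnorm1 D.
  have -> : coef K' G = coef K G + D by rewrite subrKC.
  by rewrite (le_trans (mxnorm1D _ _))// lerD.
have DB : mxnorm1 D <= m * (dd * (k * N + al * (q * (k * N) + mxnorm1 D))).
  rewrite {1}DE mxnorm1N (le_trans (mxnorm1M _ _))// ler_wpM2l//.
  rewrite (le_trans (mxnorm1M _ _))// ler_wpM2l// (le_trans (mxnorm1D _ _))// lerD//.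
  by rewrite (le_trans (mxnorm1M _ _))// ler_wpM2l.
have /andP[dd1 dd2] : (dd < d1) && (dd < d2) by rewrite -lt_min.
have small : m * dd * al <= 2^-1.
  have : dd * (2 * m * al + 1) < 1 by rewrite -ltr_pdivlMr ?mul1r// ltr_wpDl// !mulr_ge0.
  rewrite mulrDr mulr1 (_ : dd * (2 * m * al) = 2 * (m * dd * al)); last by ring.
    exact: half_le.
have DB2 : mxnorm1 D <= 2 * m * dd * (k + al * (q * k)) * N.
  have D0 := mxnorm1_ge0 D.
  have : m * dd * al * mxnorm1 D <= 2^-1 * mxnorm1 D by rewrite ler_wpM2r.
    move=> absD; move: DB; set t := mxnorm1 D.
  rewrite (_ : m * (dd * _) = m * dd * (k + al * (q * k)) * N + m * dd * al * t); last by ring.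
  rewrite (_ : 2 * m * dd * _ * N = 2 * (m * dd * (k + al * (q * k)) * N)); last by ring.
    exact: absorb.
move=> x xab.
rewrite ysol_sub; apply: (le_trans (MP _ _ xab)).
apply: (@le_trans _ _ (B * dd * N)).
  apply: (le_trans (ler_wpM2l M0 DB2)); rewrite /B le_eqVlt; apply/orP; left; apply/eqP; ring.
rewrite ler_wpM2r//.
have : dd * (B + 1) < e by rewrite -ltr_pdivlMr// ltr_wpDl.
by rewrite mulrDr mulr1 mulrC; exact: drop_lt.
Qed.

(** The vectors determine [y] and [u] at both ends. [Phi c] takes the values at [a], where [yf] and
    [uf] vanish, and these two supply what is missing at [b]. *)
Lemma boundary_onto (al be : 'cV[C]_2) : exists f y u,
  [/\ L2 f, isSol y u f, Pv y u = al & Nv y u = be].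
Proof.
pose ya : C := (al ord0 0 - be ord0 0) / (2 * Num.imaginary).
pose ua : C := (al ord0 0 + be ord0 0) / 2.
pose yb : C := (al ord_max 0 - be ord_max 0) / (2 * Num.imaginary).
pose ub : C := - (al ord_max 0 + be ord_max 0) / 2.
pose c : 'cV[C]_2 := \col_(i < 2) [:: ya; ua]`_i.
pose r := yb - Phi c b; pose s := ub - Ups c b.
(* Cramer's rule for [yf G b = r], [uf G b = s], with the Wronskian 1 as determinant. *)
pose w (i : 'I_2) : C := if i == ord0 then ups ord0 b * r - phi ord0 b * s
  else ups ord_max b * r - phi ord_max b * s.
have [f Lf wP] := primitives_onto w.
have [k k0 kP] := primitives_exist; have [G PG _] := kP f Lf.
have s1 := isSol_lin 1 (isSol_yf PG) (isSol_Phi c).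
have {}s1 : isSol (fun x => yf G x + 1 * Phi c x) (fun x => uf G x + 1 * Ups c x) f.
  by apply: isSol_ext s1; apply: aeJ_all => x _; rewrite mulr0 addr0.
exists f, (fun x => yf G x + 1 * Phi c x), (fun x => uf G x + 1 * Ups c x).
have W := wronskian bab.
have Gb0 : G ord0 b = ups ord0 b * r - phi ord0 b * s by exact: (wP G PG ord0).
have Gb1 : G ord_max b = ups ord_max b * r - phi ord_max b * s by exact: (wP G PG ord_max).
have yfb : yf G b = r.
  rewrite /yf Gb0 Gb1 -[RHS]mulr1 -W; ring.
have ufb : uf G b = s.
  rewrite /uf Gb0 Gb1 -[RHS]mulr1 -W; ring.
have yfa : yf G a = 0 by rewrite /yf (PG ord0).2 (PG ord_max).2 !mul0r subrr.
have ufa : uf G a = 0 by rewrite /uf (PG ord0).2 (PG ord_max).2 !mul0r subrr.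
have i2 : (Num.imaginary : C) != 0.
  by apply/eqP => h; have := normc_i; rewrite h Normc.normc0 => /eqP; rewrite eq_sym oner_eq0.
have c0 : c ord0 0 = ya by rewrite mxE.
have c1 : c ord_max 0 = ua by rewrite mxE.
split => //; apply: colP2;
  rewrite ?(Pv0, Pv1, Nv0, Nv1) ?yfa ?ufa ?yfb ?ufb ?Phi_left ?Ups_left ?c0 ?c1
    /r /s /ya /ua /yb /ub; field; exact: i2.
Qed.

Lemma solves_inverse_continuous K (e : R) : K \is unitarymx -> 0 < e ->
  exists2 d : R, 0 < d & forall K', K' \is unitarymx ->
  (forall f y u y' u', L2 f -> solves K f y u -> solves K' f y' u' ->
    fine (L2norm (fun x => y' x - y x)) <= d * fine (L2norm f)) ->
  mxnorm1 (K' - K) < e.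
Proof.
move=> uK e0; have [kap kap0 kapP] := coefficient_bound.
have /choice[fs fsP] : forall j : 'I_2, exists f, L2 f /\ exists y u,
    solves K f y u /\ Pv y u = delta_mx j 0.
  move=> j; have [f [y [u [Lf s hP hN]]]] := boundary_onto (delta_mx j 0) (K *m delta_mx j 0).
  by exists f; split=> //; exists y, u; split => //; split => //; apply/bcE; rewrite hP hN.
pose S := \sum_j fine (L2norm (fs j)).
have N0 j : 0 <= fine (L2norm (fs j)) by rewrite fine_ge0// L2norm_ge0.
have S0 : 0 <= S by apply: sumr_ge0.
(* Column [j] of [K' - K] will be at most [q * d * fine (L2norm (fs j))]; the 4 bounds the unitary
   [K'], and [kap] turns the L2 norm of the difference into coefficients. *)
pose q := (mxnorm1 NA + 4 * mxnorm1 PA) * kap.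
have q0 : 0 <= q by rewrite mulr_ge0// addr_ge0 ?mulr_ge0// mxnorm1_ge0.
exists (e / (q * S + 1)); first by rewrite divr_gt0// ltr_wpDl// mulr_ge0.
move=> K' uK' H; rewrite mxnorm1_columns.
set d := e / _ in H *.
have d0 : 0 < d by rewrite divr_gt0// ltr_wpDl// mulr_ge0.
apply: (@le_lt_trans _ _ (\sum_j q * d * fine (L2norm (fs j)))); last first.
  rewrite -mulr_sumr -/S.
    have : d * (q * S + 1) = e by rewrite /d mulfVK// gt_eqF// ltr_wpDl// mulr_ge0.
  by move=> <-; rewrite mulrDr mulr1 mulrA [d * q]mulrC ltrDl.
apply: ler_sum => j _; have [Lf [y [u [syu hP]]]] := fsP j.
have [k k0 kP] := primitives_exist; have [G PG _] := kP _ Lf.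
have s := solves_explicit uK PG; have s' := solves_explicit uK' PG.
have un := solves_unique uK syu s.
have hPG : Pv (ysol K G) (usol K G) = delta_mx j 0.
  by rewrite -hP; apply: Pv_eq => x xab; have [] := un x xab.
pose D := coef K' G - coef K G.
have P' : Pv (ysol K' G) (usol K' G) = delta_mx j 0 + PA *m D.
  by rewrite (Pv_ysol_sub K) hPG.
have N' : Nv (ysol K' G) (usol K' G) = K *m delta_mx j 0 + NA *m D.
  by have [_ /bcE] := s; rewrite hPG => ->; exact: Nv_ysol_sub.
have [_ /bcE] := s'; rewrite P' N' mulmxDr => E.
(* The condition of [K'] for the perturbed vectors, minus that of [K] for [e_j]. *)
have KE : (K' - K) *m delta_mx j 0 = NA *m D - K' *m (PA *m D).
  rewrite mulmxBl; apply/eqP; rewrite subr_eq addrAC eq_sym subr_eq; apply/eqP.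
  by rewrite E addrC.

have Lz : L2 (fun x => ysol K' G x - ysol K G x).
  apply: L2_sub; apply: AC_L2 => //.
    by have [] := isSol_AC s'.1.
  by have [] := isSol_AC s.1.
have DB : mxnorm1 D <= kap * (d * fine (L2norm (fs j))).
  apply: (le_trans (kapP D _ Lz _)); first by apply: aeJ_all => x _; exact: ysol_sub.
  by rewrite ler_wpM2l//; exact: (H _ _ _ _ _ Lf s s').
rewrite KE (le_trans (mxnorm1D _ _))// mxnorm1N.
apply: (@le_trans _ _ ((mxnorm1 NA + 4 * mxnorm1 PA) * mxnorm1 D)).
  rewrite mulrDl lerD ?mxnorm1M// (le_trans (mxnorm1M _ _))// -mulrA.
  by rewrite ler_pM ?mxnorm1_ge0// ?unitarymx_mxnorm1// mxnorm1M.
apply: (le_trans (ler_wpM2l _ DB)); last by rewrite /q !mulrA.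
by rewrite addr_ge0 ?mulr_ge0// mxnorm1_ge0.
Qed.
End fundamental_system.

(** * Resolvents *)

Section operator_norms.
Local Open Scope complex_scope.
Context (R : realType).
Local Notation C := R[i].
Local Notation norm := (@Normc.normc R).

Lemma opnorm_le (E : Type) (V : set E) (N : E -> \bar R) (T : E -> E) (M : R) : 0 <= M ->
  (forall v, V v -> (N (T v) <= M%:E * N v)%E) -> (opnorm V N T <= M%:E)%E.
Proof. by move=> M0 TM; apply: ereal_inf_lbound; exists M. Qed.

Lemma opnorm_lt (E : Type) (V : set E) (N : E -> \bar R) (T : E -> E) (e : R) :
  (opnorm V N T < e%:E)%E -> exists M : R, [/\ 0 <= M, M < e &
  forall v, V v -> (N (T v) <= M%:E * N v)%E].
Proof. by move=> /ereal_inf_lt[_ [M [M0 TM] <-]]; rewrite lte_fin; exists M. Qed.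

Lemma opnorm_ge0 (E : Type) (V : set E) (N : E -> \bar R) (T : E -> E) :
  (0 <= opnorm V N T)%E.
Proof. by apply: le_ereal_inf_tmp => _ [M [M0 _] <-]; rewrite lee_fin. Qed.

Lemma eq_opnorm (E : Type) (V : set E) (N : E -> \bar R) (T T' : E -> E) :
  (forall v, V v -> N (T v) = N (T' v)) -> opnorm V N T = opnorm V N T'.
Proof.
move=> TT'; rewrite /opnorm; congr (ereal_inf (image _ _)).
by apply/seteqP; split=> M [M0 TM]; split=> // v Vv; [rewrite -TT'|rewrite TT'] => //; exact: TM.
Qed.

(** The distances are extended reals and may be infinite for small [n]; either side makes them
    eventually finite. *)
Lemma ge0_cvge0P (u : nat -> \bar R) : (forall n, (0 <= u n)%E) ->
  u n @[n --> \oo] --> 0%E <->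
  (forall e : R, 0 < e -> \forall n \near \oo, (u n < e%:E)%E).
Proof.
move=> u0; split=> [/fine_cvgP[fu /cvgr0Pnorm_lt h] e /h he|h].
  near=> n; have fn : u n \is a fin_num by near: n.
  rewrite -(fineK fn) lte_fin (le_lt_trans (ler_norm _))//.
  by near: n.
have fu : \forall n \near \oo, u n \is a fin_num.
  near=> n; rewrite ge0_fin_numE// (@lt_trans _ _ 1%:E)//; last exact: ltry.
  by near: n; exact: h.
apply/fine_cvgP; split => //; apply/cvgr0Pnorm_lt => e e0.
near=> n; have fn : u n \is a fin_num by near: n.
rewrite /= ger0_norm ?fine_ge0// -lte_fin fineK//.
by near: n; exact: h.
Unshelve. all: by end_near. Qed.

Definition vnorm2 (v : 'cV[C]_2) : R := Num.sqrt (\sum_(i < 2) norm (v i 0) ^+ 2).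

Lemma vnorm2_entry (v : 'cV[C]_2) i : norm (v i 0) <= vnorm2 v.
Proof.
rewrite -[leLHS]ger0_norm ?normc_ge0// -sqrtr_sqr ler_wsqrtr// (bigD1 i)//= lerDl.
by apply: sumr_ge0 => j _; exact: sqr_ge0.
Qed.

Lemma vnorm2_le (v : 'cV[C]_2) : vnorm2 v <= mxnorm1 v.
Proof.
rewrite -[leRHS](ger0_norm (mxnorm1_ge0 v)) -sqrtr_sqr ler_wsqrtr//.
rewrite /mxnorm1 !sum2 !big_ord1 sqrrD addrAC lerDl mulrn_wge0//.
by rewrite mulr_ge0// normc_ge0.
Qed.

Lemma C2opdist_le (A B : 'M[C]_2) : (C2opdist A B <= (mxnorm1 (A - B))%:E)%E.
Proof.
apply: opnorm_le => [|v _]; first exact: mxnorm1_ge0.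
rewrite -mulmxBl -EFinM lee_fin -/(vnorm2 _) -/(vnorm2 v).
apply: (le_trans (vnorm2_le _)); rewrite /mxnorm1 mulr_suml.
apply: ler_sum => i _; rewrite big_ord1 mxE (le_trans (normc_sum _ _ _))// mulr_suml.
by apply: ler_sum => j _; rewrite Normc.normcM ler_wpM2l ?normc_ge0// vnorm2_entry.
Qed.

(** Applying the difference to basis vectors bounds each of its four entries by the operator
    norm. *)
Lemma C2opdist_lt (A B : 'M[C]_2) (e : R) :
  (C2opdist A B < e%:E)%E -> mxnorm1 (A - B) < 4 * e.
Proof.
move=> /opnorm_lt[M [M0 Me AB]].
have h i j : norm ((A - B) i j) <= M.
  have := AB (delta_mx j 0) I.
  rewrite -mulmxBl -EFinM lee_fin -/(vnorm2 _) -/(vnorm2 (delta_mx j 0)).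
  have -> : vnorm2 (delta_mx j 0) = 1.
    rewrite /vnorm2 (bigD1 j)//= big1 => [|k kj]; rewrite mxE ?eqxx.
      by rewrite addr0 Normc.normc1 expr1n sqrtr1.
    by rewrite (negbTE kj) Normc.normc0 expr0n.
  rewrite mulr1; apply: le_trans; rewrite -colE.
  by have := vnorm2_entry (col j (A - B)) i; rewrite mxE.
rewrite /mxnorm1 !sum2; have := h ord0 ord0; have := h ord0 ord_max.
by have := h ord_max ord0; have := h ord_max ord_max; lra.
Qed.

Lemma mxnorm1_adjoint (A : 'M[C]_2) : mxnorm1 (A ^t* )%sesqui = mxnorm1 A.
Proof.
rewrite /mxnorm1 exchange_big/=; apply: eq_bigr => i _; apply: eq_bigr => j _.
by rewrite !mxE normcJ.
Qed.

(** Serves to show that a limit of unitary matrices, not assumed unitary in the convergence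
    statement, is one. *)
Lemma unitarymx_closed (K : 'M[C]_2) :
  (forall e : R, 0 < e -> exists2 K' : 'M[C]_2, K' \is unitarymx & mxnorm1 (K' - K) < e) ->
  K \is unitarymx.
Proof.
move=> cl; apply/unitarymxP/eqP; rewrite -subr_eq0; apply/eqP/mxnorm1_eq0.
set X := _ - _; apply/le_anti; rewrite mxnorm1_ge0 andbT; apply/ler_addgt0Pl => e e0.
(* Here 9 is 4 + 5: [mxnorm1] is at most 4 for the unitary [K'] and, as [d <= 1], at most 5 for
   [K]. *)
rewrite addr0; pose d := Num.min 1 (e / 9).
have d0 : 0 < d by rewrite lt_min ltr01 divr_gt0.
have [K' uK' K'd] := cl d d0.
have XE : X = K' *m ((K - K') ^t* )%sesqui + (K - K') *m (K ^t* )%sesqui.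
  rewrite /X -(unitarymxP uK') linearB/= rmorphB/= mulmxBr mulmxBl.
    move: (K *m _) (K' *m (K' ^t* )%sesqui) (K' *m (K ^t* )%sesqui) => S T U.
  by rewrite [RHS]addrC addrA subrK.
have d1 : d <= 1 by rewrite ge_min lexx.
have de : d * 9 <= e by rewrite -ler_pdivlMr// ge_min lexx orbT.
have KK' : mxnorm1 (K - K') < d by rewrite -opprB mxnorm1N.
have nK : mxnorm1 K <= 5.
  rewrite -(subrK K' K) (le_trans (mxnorm1D _ _))//.
  by have := unitarymx_mxnorm1 uK'; lra.
rewrite XE (le_trans (mxnorm1D _ _))//.
have h1 := mxnorm1M K' ((K - K') ^t* )%sesqui.
have h2 := mxnorm1M (K - K') (K ^t* )%sesqui.
rewrite !mxnorm1_adjoint in h1 h2.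
have h3 : mxnorm1 K' * mxnorm1 (K - K') <= 4 * d.
  by rewrite ler_pM ?mxnorm1_ge0// ?unitarymx_mxnorm1// ltW.
have h4 : mxnorm1 (K - K') * mxnorm1 K <= d * 5 by rewrite ler_pM ?mxnorm1_ge0// ltW.
lra.
Qed.

Lemma L2opdistC (a b : R) S T : L2opdist a b S T = L2opdist a b T S.
Proof.
have h (f g : R -> C) : (L2norm a b (fun x => f x - g x)%R <= L2norm a b (fun x => g x - f x)%R)%E.
  by apply: L2norm_ae_le; apply: aeJ_all => x _; rewrite -opprB normcN'.
by apply: eq_opnorm => f _; apply/le_anti; rewrite !h.
Qed.
End operator_norms.

(** * From the operators to the first order system and back *)

Section resolvents.
Local Open Scope complex_scope.
Context (R : realType) (a b : R) (p Q g1 g2 g3 : R -> R) (lam : R[i]).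
Local Notation C := R[i].
Local Notation Im := complex.Im.
Local Notation norm := (@Normc.normc R).
Local Notation cdac := (cdac a b).
Local Notation aeJ := (aeJ a b).
Local Notation AC := (@Defs.AC R a b).
Local Notation L2 := (L2 a b).
Local Notation L2norm := (L2norm a b).
Local Notation isSol := (isSol a b g1 g2 g3 lam).
Local Notation solves := (solves a b g1 g2 g3 lam).
Local Notation D1 := (D1 a b p Q).
Local Notation D2 := (D2 a b p Q).
Local Notation Lmax := (Lmax a b p Q).
Local Notation DomLK := (DomLK a b p Q).
Local Notation Res := (resolventLK a b p Q lam).
Implicit Types (f y u : R -> C) (K : 'M[C]_2).
Context (hab : a < b) (hlam : Im lam != 0).
Context (p_neq0 : aeJae a b (fun x => p x != 0)).
Context (g1E : aeJ (fun x => (p x)^-1) g1) (g2E : aeJ (fun x => Q x / p x) g2).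
Context (g3E : aeJ (fun x => Q x ^+ 2 / p x) g3).
Context (phi ups : 'I_2 -> R -> C).
Context (solphi : forall i, isSol (phi i) (ups i) (fun=> 0)).
Context (phia : forall i, phi i a = (i == ord0)%:R).
Context (upsa : forall i, ups i a = (i == ord_max)%:R).
Let ab : a <= b := ltW hab.

Let g1_neq0 : aeJae a b (fun x => g1 x != 0).
Proof. by apply: aeJ_imp2 p_neq0 g1E => x _ px <-; rewrite invr_eq0. Qed.

Lemma AC_ae_eq f g : AC f -> AC g -> aeJ f g -> forall x, a <= x <= b -> f x = g x.
Proof.
move=> af ag fg x xab; apply/eqP; rewrite -subr_eq0; apply/eqP.
apply: (AC_ae0 (F := fun x => f x - g x) hab) => //.
  exact: cdac_AC (cdac_sub (AC_cdac ab af) (AC_cdac ab ag)).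
by apply: aeJ_imp fg => t _ ->; rewrite subrr.
Qed.

Lemma ACrep_ae f : AC (ACrep a b f) -> aeJ (ACrep a b f) f.
Proof.
rewrite /ACrep => af; have [[u Pu]|nu] := pselect (exists u, AC u /\ aeJ u f).
  by have [] := xgetI f (Pu : [set u | AC u /\ aeJ u f] u).
move: af; rewrite (xgetPN f) => [_|v Pv]; first exact: aeJ_all.
by apply: nu; exists v.
Qed.

(** [u] equals [p y' - Q y] almost everywhere by the first equation; two absolutely continuous
    representatives agree on all of [a, b], so also in the boundary values. *)
Lemma D1_solution y u f : isSol y u f ->
  AC (D1 y) /\ forall x, a <= x <= b -> D1 y x = u x.
Proof.
move=> s; have [aY aU] := isSol_AC s; have dy := cdac_cderive s.1.
have ue : aeJ u (fun x => (p x)%:C * cderive y x - (Q x)%:C * y x).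
  have pg : aeJae a b (fun x => p x != 0 /\ (p x)^-1 = g1 x).
    by apply: aeJ_imp2 p_neq0 g1E.
  apply: aeJ_imp3 pg g2E dy => x _ [px h1] h2 ->; rewrite -h1 -h2.
  by apply: complex_eqP; rewrite !cE; field.
have [h1 h2] := xgetI (fun x => (p x)%:C * cderive y x - (Q x)%:C * y x) (conj aU ue :
  [set u | AC u /\ aeJ u (fun x => (p x)%:C * cderive y x - (Q x)%:C * y x)] u).
split=> //; apply: AC_ae_eq => //; apply: aeJ_trans h2 _; exact: aeJ_sym.
Qed.

Lemma DomLK_solves K y f : DomLK K y -> aeJ (fun x => Lmax y x - lam * y x) f ->
  solves K f y (D1 y).
Proof.
move=> [[_ aY aD _] bcy] eqf; split; last exact: bcy.
have pg : aeJae a b (fun x => p x != 0 /\ (p x)^-1 = g1 x) by apply: aeJ_imp2 p_neq0 g1E.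
split.
  apply: cdac_ext (AC_cdac ab aY) _.
    apply: aeJ_imp3 pg g2E (ACrep_ae aD) => x _ [px <-] <- D1E.
  rewrite [D1 y x]D1E.
  by apply: complex_eqP; rewrite !cE; field.
apply: cdac_ext (AC_cdac ab aD) _; apply: aeJ_imp3 g2E g3E eqf => x _ <- <- <-.
rewrite /Defs.Lmax /Defs.D2; ring.
Qed.

Lemma solves_DomLK K y u f : L2 f -> solves K f y u ->
  DomLK K y /\ aeJ (fun x => Lmax y x - lam * y x) f.
Proof.
move=> Lf [s bcy]; have [aD DE] := D1_solution s; have [aY aU] := isSol_AC s.
have dD : cdac (D1 y) (fun x => - (g2 x)%:C * u x - ((g3 x)%:C + lam) * y x - f x).
  by apply: cdac_eq s.2 => x xab; rewrite DE.
have D2E : aeJ (D2 y) (fun x => - lam * y x - f x).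
  apply: aeJ_imp3 g2E g3E (cdac_cderive dD) => x /andP[/ltW xa /ltW xb] h2 h3 h.
  by rewrite /Defs.D2 h DE ?xa// h2 h3; ring.
split; last by apply: aeJ_imp D2E => x _ h; rewrite /Defs.Lmax h; ring.
split.
  split => //; first exact: AC_L2.
  (* [D2 y] is square integrable because the equation makes it [- lam y - f]. *)
  apply: L2_ext (aeJ_sym D2E) _; apply: L2_sub => //; apply: AC_L2 => //.
  exact: cdac_AC (cdac_scale _ (AC_cdac ab aY)).
have := bcy; rewrite /bc; have -> : G1v a b u = Gamma1 a b p Q y; last by [].
by apply: colP2; rewrite !mxE /= DE// ?lexx ?ab.
Qed.

(** [resolvent] chooses some solution; by uniqueness the choice agrees with any given one on
    [a, b]. *)
Lemma resolventLK_ae K f y u : K \is unitarymx -> L2 f -> solves K f y u ->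
  aeJ (Res K f) y.
Proof.
move=> uK Lf s; have [d e] := solves_DomLK Lf s.
have [d' e'] := xgetI (cst 0) (conj d e :
  [set y | DomLK K y /\ aeJ (fun x => Lmax y x - lam * y x) f] y).
apply: aeJ_all => x /andP[/ltW xa /ltW xb].
have [|h _] := solves_unique hab hlam g1_neq0 uK (DomLK_solves d' e') s (x := x).
  by rewrite xa.
exact: h.
Qed.

Lemma L2norm_le_scaled y f (k : R) : 0 <= k -> L2 f ->
  (forall x, a <= x <= b -> norm (y x) <= k * fine (L2norm f)) ->
  (L2norm y <= (k * Num.sqrt (b - a))%:E * L2norm f)%E.
Proof.
move=> k0 Lf yk; rewrite -(fineK (L2norm_fin Lf)) -EFinM mulrAC.
apply: L2norm_le_cst => //; first by rewrite mulr_ge0// fine_ge0// L2norm_ge0.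
by apply: aeJ_all => x /andP[/ltW xa /ltW xb]; rewrite yk// xa.
Qed.

Lemma in_resolvent_set_DomLK K : K \is unitarymx -> in_resolvent_set a b (DomLK K) Lmax lam.
Proof.
move=> uK; have [k k0 kP] := solves_exists hab hlam g1_neq0 solphi phia upsa uK; split.
- move=> f Lf; have [y [u [s _]]] := kP f Lf.
  by have [? ?] := solves_DomLK Lf s; exists y.
- move=> y d e; have [s bcy] := DomLK_solves d e.
  apply: aeJ_all => x /andP[/ltW xa /ltW xb].
  have [|h _] := isSol_zero hab hlam g1_neq0 s (bc_green uK bcy) (x := x); last exact: h.
  by rewrite xa.
- apply: (@le_lt_trans _ _ (k * Num.sqrt (b - a))%:E); last exact: ltry.
  apply: opnorm_le => [|f Lf]; first by rewrite mulr_ge0// sqrtr_ge0.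
  have [y [u [s yk]]] := kP f Lf.
  by rewrite (L2norm_ae_eq (resolventLK_ae uK Lf s)) L2norm_le_scaled.
Qed.

Lemma resolventLK_continuous K (e : R) : K \is unitarymx -> 0 < e -> exists2 d : R, 0 < d &
  forall K', K' \is unitarymx -> (C2opdist K' K < d%:E)%E ->
  (L2opdist a b (Res K') (Res K) < e%:E)%E.
Proof.
move=> uK e0; pose s := Num.sqrt (b - a); have s0 : 0 <= s by exact: sqrtr_ge0.
(* The operator norm will be at most [e' * s <= e / 2], strictly below [e]. *)
pose e' := e / 2 / (s + 1); have s1 : 0 < s + 1 by rewrite ltr_wpDl.
have e'0 : 0 < e' by rewrite !divr_gt0.
have [d d0 dP] := solves_continuous hab hlam g1_neq0 solphi phia upsa uK e'0.
exists (d / 4); first exact: divr_gt0.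
move=> K' uK' /C2opdist_lt; rewrite mulrC divfK// => K'd.
apply: (@le_lt_trans _ _ (e' * s)%:E); last first.
  have es : e' * (s + 1) = e / 2 by rewrite /e' divfK// gt_eqF.
  have : e' * s <= e' * (s + 1) by rewrite ler_wpM2l ?ltW// ltrDl.
  by rewrite es lte_fin => /le_lt_trans; apply; rewrite ltr_pdivrMr// mulr_natr mulr2n ltrDl.
apply: opnorm_le => [|f Lf]; first by rewrite mulr_ge0// ltW.
have [y [u [y' [u' [sy sy' yy']]]]] := dP K' uK' K'd f Lf.
rewrite (@L2norm_ae_eq _ _ _ _ (fun x => y' x - y x)).
  by apply: L2norm_le_scaled => //; exact: ltW.
by apply: aeJ_imp2 (resolventLK_ae uK Lf sy) (resolventLK_ae uK' Lf sy') => x _ -> ->.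
Qed.

(** Closeness is expressed vector by vector, a form that serves both the continuity of the inverse
    and injectivity. *)
Lemma resolventLK_inverse_bound K (e : R) : K \is unitarymx -> 0 < e -> exists2 d : R, 0 < d &
  forall K', K' \is unitarymx ->
  (forall f, L2 f -> (L2norm (fun x => Res K' f x - Res K f x)%R <= d%:E * L2norm f)%E) ->
  mxnorm1 (K' - K) < e.
Proof.
move=> uK e0; have [d d0 dP] := solves_inverse_continuous hab hlam g1_neq0 solphi phia upsa uK e0.
exists d => // K' uK' H; apply: dP => // f y u y' u' Lf sy sy'.
rewrite -lee_fin EFinM (fineK (L2norm_fin Lf)).
have <- : L2norm (fun x => Res K' f x - Res K f x) = L2norm (fun x => y' x - y x).
  apply: L2norm_ae_eq.
  by apply: aeJ_imp2 (resolventLK_ae uK Lf sy) (resolventLK_ae uK' Lf sy') => x _ -> ->.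
rewrite fineK ?H// ge0_fin_numE ?L2norm_ge0//; apply: (le_lt_trans (H f Lf)).
by rewrite -(fineK (L2norm_fin Lf)) -EFinM ltry.
Qed.

Lemma resolventLK_inverse_continuous K (e : R) : K \is unitarymx -> 0 < e ->
  exists2 d : R, 0 < d & forall K', K' \is unitarymx ->
  (L2opdist a b (Res K') (Res K) < d%:E)%E -> (C2opdist K' K < e%:E)%E.
Proof.
move=> uK e0; have [d d0 dP] := resolventLK_inverse_bound uK e0.
exists d => // K' uK' /opnorm_lt[M [M0 Md MP]].
apply: (le_lt_trans (C2opdist_le _ _)); rewrite lte_fin; apply: dP => // f Lf.
by apply: (le_trans (MP f Lf)); rewrite lee_wpmul2r ?L2norm_ge0// lee_fin ltW.
Qed.

(** Equal resolvents satisfy the bound of [resolventLK_inverse_bound] for every [d], so [K' - K] is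
    smaller than any [e]. *)
Lemma resolventLK_inj K K' : K \is unitarymx -> K' \is unitarymx ->
  L2opeq a b (Res K) (Res K') -> K = K'.
Proof.
move=> uK uK' eqR; apply/esym/eqP; rewrite -subr_eq0; apply/eqP/mxnorm1_eq0/le_anti.
rewrite mxnorm1_ge0 andbT; apply/ler_addgt0Pl => e e0; rewrite addr0 ltW//.
have [d d0 dP] := resolventLK_inverse_bound uK e0; apply: dP => // f Lf.
apply: (@le_trans _ _ 0%E); last by rewrite mule_ge0 ?L2norm_ge0// lee_fin ltW.
have := @L2norm_le_cst _ a b (fun x => Res K' f x - Res K f x) 0 ab (lexx _).
rewrite mul0r; apply; apply: aeJ_imp (eqR f Lf) => x _ ->.
by rewrite subrr Normc.normc0.
Qed.
End resolvents.

Lemma fundamental_system_exists (R : realType) (a b : R) (g1 g2 g3 : R -> R) (lam : R[i]) :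
  a <= b -> intJ a b g1 -> intJ a b g2 -> intJ a b g3 -> exists phi ups : 'I_2 -> R -> R[i],
  [/\ forall i, isSol a b g1 g2 g3 lam (phi i) (ups i) (fun=> 0),
      forall i, phi i a = (i == ord0)%:R & forall i, ups i a = (i == ord_max)%:R].
Proof.
move=> ab i1 i2 i3.
have ex (i : 'I_2) : exists yu : (R -> R[i]) * (R -> R[i]),
    [/\ isSol a b g1 g2 g3 lam yu.1 yu.2 (fun=> 0), yu.1 a = (i == ord0)%:R &
        yu.2 a = (i == ord_max)%:R].
  have [y [u [s ya ua]]] := isSol_exists lam (i == ord0)%:R (i == ord_max)%:R ab i1 i2 i3.
  by exists (y, u).
have /choice[yu yuP] := ex.
by exists (fun i => (yu i).1), (fun i => (yu i).2); split=> i; have [] := yuP i.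
Qed.

Theorem mainTheorem3 (R : realType) (a b : R) (p Q : R -> R)
    (hab : a < b)
    (hp : lebesgue_measurable a b p) (hQ : lebesgue_measurable a b Q)
    (hp0 : {ae @lebesgue_measure R, forall x, `]a, b[%classic x -> p x != 0})
    (hp1 : L1 a b (fun x => (p x)^-1))
    (hQ1 : L1 a b (fun x => Q x / p x))
    (hQ2 : L1 a b (fun x => Q x ^+ 2 / p x))
    (lambda : R[i]) (hlambda : complex.Im lambda != 0) :
  [/\ (* the resolvents are everywhere defined bounded operators *)
      forall K : 'M[R[i]]_2, K \is unitarymx ->
        in_resolvent_set a b (DomLK a b p Q K) (Lmax a b p Q) lambda,
      forall (K_ : nat -> 'M[R[i]]_2) (K : 'M[R[i]]_2),
        (forall n, K_ n \is unitarymx) ->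
        C2opdist (K_ n) K @[n --> \oo] --> 0%E ->
        L2opdist a b (resolventLK a b p Q lambda K)
          (resolventLK a b p Q lambda (K_ n)) @[n --> \oo] --> 0%E,
      forall (K_ : nat -> 'M[R[i]]_2) (K : 'M[R[i]]_2),
        (forall n, K_ n \is unitarymx) -> K \is unitarymx ->
        L2opdist a b (resolventLK a b p Q lambda K)
          (resolventLK a b p Q lambda (K_ n)) @[n --> \oo] --> 0%E ->
        C2opdist (K_ n) K @[n --> \oo] --> 0%E
    & homeomorphism_onto_image [set K : 'M[R[i]]_2 | K \is unitarymx]
        (@C2opdist R) (L2opeq a b) (L2opdist a b)
        (resolventLK a b p Q lambda)].
Proof.
have [g1 i1 g1E] := hp1; have [g2 i2 g2E] := hQ1; have [g3 i3 g3E] := hQ2.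
have [phi [ups [sp pa ua]]] := fundamental_system_exists lambda (ltW hab) i1 i2 i3.
have cont K := resolventLK_continuous hab hlambda hp0 g1E g2E g3E sp pa ua (K := K).
have inv K := resolventLK_inverse_continuous hab hlambda hp0 g1E g2E g3E sp pa ua (K := K).
have L0 S T : (0 <= L2opdist a b S T)%E by exact: opnorm_ge0.
have C0 (A B : 'M[R[i]]_2) : (0 <= C2opdist A B)%E by exact: opnorm_ge0.
split.
- by move=> K; exact: (in_resolvent_set_DomLK hab hlambda hp0 g1E g2E g3E sp pa ua).
- move=> K_ K uK_ /(ge0_cvge0P (fun n => C0 _ _)) Kn.
  have uK : K \is unitarymx.
    apply: unitarymx_closed => e e0; have e40 : 0 < e / 4 by rewrite divr_gt0.
    have [n _ /(_ _ (leqnn n)) h] := Kn _ e40; exists (K_ n) => //.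
    by have := C2opdist_lt h; rewrite mulrC divfK.
  apply/(ge0_cvge0P (fun n => L0 _ _)) => e e0; have [d d0 dP] := cont K e uK e0.
    apply: filterS (Kn d d0) => n h.
  by rewrite (L2opdistC a b (resolventLK a b p Q lambda K)); exact: dP.
- move=> K_ K uK_ uK /(ge0_cvge0P (fun n => L0 _ _)) Kn.
  apply/(ge0_cvge0P (fun n => C0 _ _)) => e e0; have [d d0 dP] := inv K e uK e0.
    apply: filterS (Kn d d0) => n; rewrite (L2opdistC a b (resolventLK a b p Q lambda K)).
  exact: dP.
- split => [K K' uK uK'|K uK e e0|K uK e e0].
  + exact: (resolventLK_inj hab hlambda hp0 g1E g2E g3E sp pa ua).
  + exact: cont.
  + exact: inv.
Qed.
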